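(* Let $\rho,\sigma,\tau$ be set partitions of $\underline{n}$ with exactly $k$, $l$ and $m$ parts, respectively. Let $\mathcal{O}$ be an $(S_k\times S_l)$-orbit in $Q_{k,l}^m$, let $M\in\mathcal{O}$, and let $H$ be the stabilizer of $M$ in $S_k\times S_l$, also regarded as a subgroup of $S_m$ via its permutation action on the $m$ entries of $M$ equal to $1$. Then, for all $\lambda\vdash k$, $\mu\vdash l$ and $\nu\vdash m$, $$\left[\Bbbk\,\mathcal{Y}_{\mathcal{O}}\otimes_{\Bbbk[S_k\times S_l]}\big(\mathbf{S}^\lambda\otimes_\Bbbk\mathbf{S}^\mu\big):\mathbf{S}^\nu\right]=\left[\mathrm{Ind}^{S_m}_H\mathrm{Res}^{S_k\times S_l}_H\big(\mathbf{S}^\lambda\otimes_\Bbbk\mathbf{S}^\mu\big):\mathbf{S}^\nu\right].$$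
   Context: $\Bbbk$ is an algebraically closed field of characteristic zero; $\underline{n}=\{1,\dots,n\}$; $\mathbf{S}^\lambda$ denotes the Specht module of a symmetric group; $[V:\mathbf{S}^\nu]$ denotes the multiplicity of $\mathbf{S}^\nu$ in the $\Bbbk[S_m]$-module $V$. Dual symmetric inverse semigroup $I_n^*$: an element $\xi$ consists of two set partitions $\mathrm{dom}(\xi)$, $\mathrm{cod}(\xi)$ of $\underline{n}$ with the same number of parts and a bijection $\overline{\xi}$ from the parts of $\mathrm{dom}(\xi)$ to the parts of $\mathrm{cod}(\xi)$. The product $\xi\zeta$ (right to left) is: let $\omega$ be the finest set partition of $\underline{n}$ coarser than both $\mathrm{cod}(\zeta)$ and $\mathrm{dom}(\xi)$; for each part $B$ of $\omega$, $\xi\zeta$ has a domain part equal to the union of all $\overline{\zeta}^{-1}(C)$, with $C\subseteq B$ a part of $\mathrm{cod}(\zeta)$, mapped to the codomain part equal to the union of all $\overline{\xi}(D)$, with $D\subseteq B$ a part of $\mathrm{dom}(\xi)$. For a set partition $\rho$, $\varepsilon_\rho$ is the idempotent with domain and codomain $\rho$ and identity bijection; $\mathbf{L}_\rho=\{\xi\in I_n^*:\mathrm{dom}(\xi)=\rho\}$; the maximal subgroup $S_\rho=\{\xi:\mathrm{dom}(\xi)=\mathrm{cod}(\xi)=\rho\}$ is the symmetric group on the parts of $\rho$. $Q_{k,l}^{m}$ is the set of all $k\times l$ matrices with $0/1$-entries with exactly $m$ entries equal to $1$, all rows non-zero and all columns non-zero. $S_k\times S_l$ acts on it by independent permutations of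 rows and columns. If $H$ is the stabilizer of $M$, each element of $H$ permutes the $m$ entries of $M$ equal to $1$; after fixing a bijection between these entries and $\underline{m}$ this gives an injective homomorphism $H\to S_m$. Fix linear orderings of the parts of $\rho$ and of the parts of $\sigma$. For two set partitions $\tilde\rho,\tilde\sigma$, $\tilde\rho\cap\tilde\sigma$ is the set partition whose parts are the non-empty intersections of a part of $\tilde\rho$ with a part of $\tilde\sigma$. $\mathcal{Y}$ is the set of all $\xi\otimes\zeta$ with $\xi\in\mathbf{L}_\rho$, $\zeta\in\mathbf{L}_\sigma$ and $\mathrm{cod}(\xi)\cap\mathrm{cod}(\zeta)=\tau$. $\mathcal{Y}_{\mathcal{O}}\subseteq\mathcal{Y}$ consists of those $\xi\otimes\zeta$ for which the $k\times l$ matrix whose $(i,j)$-entry is $1$ if the $i$-th part of $\mathrm{cod}(\xi)$ meets the $j$-th part of $\mathrm{cod}(\zeta)$, and $0$ otherwise, belongs to $\mathcal{O}$ (this does not depend on the orderings chosen for the parts of $\mathrm{cod}(\xi)$ and $\mathrm{cod}(\zeta)$). $\Bbbk\,\mathcal{Y}_{\mathcal{O}}$, the vector space with basis $\mathcal{Y}_\mathcal{O}$, is a $\Bbbk[S_m]$-$\Bbbk[S_k\times S_l]$-bimodule: $S_m\cong S_\tau$ acts on the left diagonally by left multiplication (permuting the parts of $\tau$), $S_k\cong S_\rho$ acts by right multiplication on $\xi$, and $S_l\cong S_\sigma$ acts by right multiplication on $\zeta$. *)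

(* Defs.v *)
From HB Require Import structures.
From mathcomp Require Import all_boot all_order all_algebra all_fingroup.
From mathcomp Require Import all_solvable all_field all_character.
From mathcomp Require Import boolp.
Set Implicit Arguments.
Unset Strict Implicit.
Unset Printing Implicit Defensive.
Import GroupScope GRing.Theory.
Local Open Scope ring_scope.

(* Side conventions.  In MathComp, (g * h : 'S_m) is "g, then h", and a        *)
(* representation acts on row vectors from the right: v *m rG (g * h) =       *)
(* (v *m rG g) *m rG h.  Writing g.v for v *m rG g, this is a left module      *)
(* over the symmetric group whose product is composition from right to left.  *)
(* So every left k[S_m]-module is an mx_representation below, with the same    *)
(* underlying permutations, and a right k[S_k x S_l]-module is a family of     *)
(* matrices that reverses the MathComp product.                               *)

Section Orderings.
Variables (T : finType) (A : {set T}) (m : nat).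

(* The bijections 'I_m -> A; this type is inhabited exactly when #|A| = m. *)
Record ordering := Ordering {
  ordering_fun :> {ffun 'I_m -> T};
  orderingP : injectiveb ordering_fun && (ordering_fun @: setT == A) }.

HB.instance Definition _ := [isSub for ordering_fun].
HB.instance Definition _ := [Finite of ordering by <:].

Lemma ordering_inj (r : ordering) : injective r.
Proof. by case/andP: (orderingP r) => /injectiveP. Qed.

Lemma ordering_im (r : ordering) : r @: setT = A.
Proof. by case/andP: (orderingP r) => _ /eqP. Qed.

Lemma ordering_mem (r : ordering) i : r i \in A.
Proof. by rewrite -(ordering_im r) imset_f. Qed.

Lemma ordering_surj (r : ordering) a : a \in A -> exists i, a = r i.
Proof. by rewrite -{1}(ordering_im r) => /imsetP[i _ ->]; exists i. Qed.

End Orderings.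

Section SetPartitions.
Variable n : nat.
Implicit Types P Q R : {set {set 'I_n}}.

Record setpart := SetPart {
  blocks :> {set {set 'I_n}};
  blocksP : partition blocks [set: 'I_n] }.

Lemma partition_ex P a : partition P setT -> exists2 A, A \in P & a \in A.
Proof.
case/and3P=> /eqP covP tiP _; exists (pblock P a).
  by rewrite pblock_mem // covP.
by rewrite mem_pblock covP.
Qed.

Lemma partition_eq P A B a :
  partition P setT -> A \in P -> B \in P -> a \in A -> a \in B -> A = B.
Proof.
case/and3P=> _ tiP _ PA PB aA aB.
by rewrite -(def_pblock tiP PA aA) (def_pblock tiP PB aB).
Qed.

Lemma partition_n0 P A : partition P setT -> A \in P -> exists a, a \in A.
Proof.
case/and3P=> _ _ P0 PA; apply/set0Pn.
by apply: contraNneq P0 => <-.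
Qed.

Lemma partition_intro P :
    (forall a, exists2 A, A \in P & a \in A) ->
    (forall A B a, A \in P -> B \in P -> a \in A -> a \in B -> A = B) ->
    (forall A, A \in P -> exists a, a \in A) ->
  partition P setT.
Proof.
move=> exP eqP' n0P; apply/and3P; split.
- apply/eqP/setP=> a; rewrite inE; have [A PA aA] := exP a.
  by apply/bigcupP; exists A.
- apply/trivIsetP=> A B PA PB; apply: contraR => /pred0Pn[a /andP[/= aA aB]].
  by apply/eqP; apply: (eqP' _ _ a).
by apply/negP=> /n0P[a]; rewrite inE.
Qed.

(* For set partitions: Q is coarser than P. *)
Definition coarser P Q := [forall A in P, exists B in Q, A \subset B].

Lemma coarserP P Q :
  reflect (forall A, A \in P -> exists2 B, B \in Q & A \subset B) (coarser P Q).
Proof. by apply: (iffP 'forall_in_exists_inP). Qed.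

Lemma coarser_anti P Q :
  partition P setT -> partition Q setT -> coarser P Q -> coarser Q P -> P = Q.
Proof.
move=> pP pQ.
have sub P' Q' : partition P' setT -> partition Q' setT ->
    coarser P' Q' -> coarser Q' P' -> P' \subset Q'.
  move=> pP' pQ' /coarserP PQ /coarserP QP; apply/subsetP=> A PA.
  have [B QB sAB] := PQ _ PA; have [C PC sBC] := QP _ QB.
  have [a aA] := partition_n0 pP' PA.
  have eqAC : A = C.
    by apply: (partition_eq (a := a) pP') => //; apply/(subsetP sBC)/(subsetP sAB).
  have -> : A = B by apply/eqP; rewrite eqEsubset sAB eqAC sBC.
  exact: QB.
by move=> PQ QP; apply/eqP; rewrite eqEsubset !sub.
Qed.

Definition linked P Q : rel 'I_n :=
  [rel a b | [exists A in P :|: Q, (a \in A) && (b \in A)]].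

(* The finest set partition coarser than both P and Q: see joinP. *)
Definition join P Q : {set {set 'I_n}} :=
  equivalence_partition (connect (linked P Q)) setT.

Definition meet P Q : {set {set 'I_n}} :=
  [set A :&: B | A in P, B in Q & A :&: B != set0].

Lemma linked_sym P Q : connect_sym (linked P Q).
Proof.
apply: sym_connect_sym => a b.
by apply/existsP/existsP=> -[A /and3P[? ? ?]]; exists A; apply/and3P.
Qed.

Lemma linked_equiv P Q :
  {in setT & &, equivalence_rel (connect (linked P Q))}.
Proof.
move=> a b c _ _ _; apply: (equivalence_relP _).2.
by split; [apply: connect0 | apply: (same_connect (@linked_sym P Q))].
Qed.

Lemma join_partition P Q : partition (join P Q) setT.
Proof. exact/equivalence_partitionP/linked_equiv. Qed.

Lemma mem_join P Q a : [set b | connect (linked P Q) a b] \in join P Q.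
Proof. by apply/imsetP; exists a; rewrite ?inE //; apply/setP=> b; rewrite !inE. Qed.

Lemma coarser_joinU P Q A :
  A \in P :|: Q -> set0 \notin P :|: Q ->
  exists2 B, B \in join P Q & A \subset B.
Proof.
move=> PQA PQ0; have /set0Pn[a aA] : A != set0 by apply: contraNneq PQ0 => <-.
exists [set b | connect (linked P Q) a b]; first exact: mem_join.
apply/subsetP=> b bA; rewrite inE; apply: connect1.
by apply/existsP; exists A; rewrite PQA aA.
Qed.

Lemma joinP P Q : partition P setT -> partition Q setT ->
  [/\ partition (join P Q) setT, coarser P (join P Q), coarser Q (join P Q)
    & forall R, partition R setT -> coarser P R -> coarser Q R ->
        coarser (join P Q) R].
Proof.
move=> pP pQ; have PQ0 : set0 \notin P :|: Q.
  by rewrite inE negb_or; case/and3P: pP => _ _ ->; case/and3P: pQ.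
split=> [|||R pR /coarserP PR /coarserP QR]; first exact: join_partition.
- by apply/coarserP=> A PA; apply: coarser_joinU; rewrite // inE PA.
- by apply/coarserP=> A QA; apply: coarser_joinU; rewrite // inE QA orbT.
apply/coarserP=> _ /imsetP[a _ ->]; have [B RB aB] := partition_ex a pR.
exists B => //; apply/subsetP=> b; rewrite !inE /= => /connectP[s ps ->].
elim: s a aB ps => //= c s IHs a aB /andP[/existsP[A /and3P[PQA aA cA]] ps].
apply: IHs ps; have [C RC /subsetP sAC] : exists2 C, C \in R & A \subset C.
  by move: PQA; rewrite inE => /orP[/PR|/QR].
by rewrite (partition_eq pR RB RC aB (sAC _ aA)) sAC.
Qed.

Lemma coarser_refl P : coarser P P.
Proof. by apply/coarserP=> A PA; exists A. Qed.

Lemma join_idl P Q : partition P setT -> partition Q setT ->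
  coarser Q P -> join P Q = P.
Proof.
move=> pP pQ QP; have [pJ PJ QJ finJ] := joinP pP pQ.
by apply: coarser_anti => //; apply: finJ => //; apply: coarser_refl.
Qed.

End SetPartitions.

Section DualSymmetricInverse.
Variable n : nat.
Implicit Types (P Q R : {set {set 'I_n}}) (x y z : {set {set 'I_n} * {set 'I_n}}).

(* An element of the dual symmetric inverse semigroup is encoded by the graph  *)
(* of its bijection: a set of pairs (domain part, codomain part).             *)
Definition gdom x := [set p.1 | p in x].
Definition gcod x := [set p.2 | p in x].

Definition is_block_bij x :=
  [&& partition (gdom x) setT, partition (gcod x) setT &
      [forall p in x, forall q in x, (p.1 == q.1) == (p.2 == q.2)]].

Record dualsym := DualSym {
  graph :> {set {set 'I_n} * {set 'I_n}};
  graphP : is_block_bij graph }.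

HB.instance Definition _ := [isSub for graph].
HB.instance Definition _ := [Finite of dualsym by <:].

(* The product x y, with y applied first. *)
Definition gmul x y : {set {set 'I_n} * {set 'I_n}} :=
  [set (\bigcup_(q in y | q.2 \subset B) q.1,
        \bigcup_(p in x | p.1 \subset B) p.2) | B : {set 'I_n} in join (gcod y) (gdom x)].


Lemma block_bij_eq x p q :
  is_block_bij x -> p \in x -> q \in x -> (p.1 == q.1) = (p.2 == q.2).
Proof. by case/and3P=> _ _ /forall_inP H px qx; have /forall_inP Hp := H _ px; by have /eqP := Hp _ qx. Qed.

Lemma block_bij_inj1 x : is_block_bij x -> {in x &, injective fst}.
Proof.
move=> bx [p1 p2] [q1 q2] px qx /= e.
by have := block_bij_eq bx px qx; rewrite /= e eqxx => /esym/eqP->.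
Qed.

Lemma block_bij_inj2 x : is_block_bij x -> {in x &, injective snd}.
Proof.
move=> bx [p1 p2] [q1 q2] px qx /= e.
by have := block_bij_eq bx px qx; rewrite /= e eqxx => /eqP->.
Qed.

Lemma gdomP (x : dualsym) : partition (gdom x) setT.
Proof. by case/and3P: (graphP x). Qed.

Lemma gcodP (x : dualsym) : partition (gcod x) setT.
Proof. by case/and3P: (graphP x). Qed.

Lemma block_union (I : finType) (g : {set I}) (f h : I -> {set 'I_n}) Q
    (U := fun B : {set 'I_n} => \bigcup_(p in g | h p \subset B) f p) :
    {in g &, injective f} -> partition (f @: g) setT ->
    partition (h @: g) setT -> partition Q setT -> coarser (h @: g) Q ->
  partition (U @: Q) setT /\ {in Q &, injective U}.
Proof.
move=> injf pf ph pQ /coarserP chQ.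
have disjU B C a : B \in Q -> C \in Q -> a \in U B -> a \in U C -> B = C.
  move=> QB QC /bigcupP[p /andP[gp hpB] ap] /bigcupP[q /andP[gq hqC] aq].
  have epq : p = q.
    by apply: injf => //; apply: (partition_eq pf _ _ ap aq); apply: imset_f.
  have [b bp] := partition_n0 ph (imset_f h gp).
  apply: (partition_eq (a := b) pQ) => //; first exact: (subsetP hpB).
  by apply: (subsetP hqC); rewrite -epq.
have n0U B : B \in Q -> exists a, a \in U B.
  move=> QB; have [b bB] := partition_n0 pQ QB.
  have [_ /imsetP[p gp ->] bp] := partition_ex b ph.
  have [C QC sC] := chQ _ (imset_f h gp).
  have eBC : B = C by apply: (partition_eq pQ _ _ bB) => //; apply: (subsetP sC).
  have [a ap] := partition_n0 pf (imset_f f gp).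
  by exists a; apply/bigcupP; exists p => //; rewrite gp eBC.
split; last first.
  move=> B C QB QC e; have [a aB] := n0U _ QB.
  by apply: (disjU _ _ a) => //; rewrite -e.
apply: partition_intro => [a|_ _ a /imsetP[B QB ->] /imsetP[C QC ->] aB aC|A].
- have [_ /imsetP[p gp ->] ap] := partition_ex a pf.
  have [C QC sC] := chQ _ (imset_f h gp).
  by exists (U C); [apply: imset_f | apply/bigcupP; exists p; rewrite ?gp].
- by rewrite (disjU B C a).
by case/imsetP=> B QB ->; apply: n0U.
Qed.

Lemma gmulP (x y : dualsym) : is_block_bij (gmul x y).
Proof.
have [pJ cJ dJ _] := joinP (gcodP y) (gdomP x).
have [pU iU] := block_union (block_bij_inj1 (graphP y)) (gdomP y) (gcodP y) pJ cJ.
have [pV iV] := block_union (block_bij_inj2 (graphP x)) (gcodP x) (gdomP x) pJ dJ.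
apply/and3P; split; first by rewrite /gdom -imset_comp.
  by rewrite /gcod -imset_comp.
apply/forall_inP=> _ /imsetP[B JB ->]; apply/forall_inP=> _ /imsetP[C JC ->] /=.
by rewrite (inj_in_eq iU) // (inj_in_eq iV).
Qed.

Definition dmul (x y : dualsym) : dualsym := DualSym (gmulP x y).

Section SymmetricSubgroup.
Variables (R : setpart n) (k : nat) (r : ordering R k).

(* The element of the maximal subgroup at R given by g via the ordering r. *)
Definition sym_graph (g : 'S_k) : {set {set 'I_n} * {set 'I_n}} :=
  [set (r i, r (g i)) | i : 'I_k].

Lemma gdom_sym g : gdom (sym_graph g) = R.
Proof.
apply/setP=> A; rewrite -(ordering_im r) /gdom -imset_comp.
by apply/imsetP/imsetP=> -[i _ ->]; exists i.
Qed.

Lemma gcod_sym g : gcod (sym_graph g) = R.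
Proof.
apply/setP=> A; rewrite -(ordering_im r) /gcod -imset_comp.
apply/imsetP/imsetP=> -[i _ ->]; first by exists (g i).
by exists (g^-1%g i); rewrite //= permKV.
Qed.

Lemma sym_graphP g : is_block_bij (sym_graph g).
Proof.
rewrite /is_block_bij gdom_sym gcod_sym blocksP /=.
apply/forall_inP=> _ /imsetP[i _ ->]; apply/forall_inP=> _ /imsetP[j _ ->] /=.
by rewrite !(inj_eq (@ordering_inj _ _ _ r)) (inj_eq perm_inj).
Qed.

Definition sym_elt g : dualsym := DualSym (sym_graphP g).

(* The effect of left multiplication by sym_elt g on a codomain part B. *)
Definition push (g : 'S_k) (B : {set 'I_n}) : {set 'I_n} :=
  \bigcup_(i | r i \subset B) r (g i).

Lemma mem_block i a j : a \in r i -> a \in r j -> i = j.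
Proof.
move=> ai aj; apply: (@ordering_inj _ _ _ r).
by apply: (partition_eq (blocksP R) _ _ ai aj); apply: ordering_mem.
Qed.

Lemma block_n0 i : exists a, a \in r i.
Proof. exact: partition_n0 (blocksP R) (ordering_mem r i). Qed.

Lemma sub_push g B i : (r i \subset push g B) = (r (g^-1%g i) \subset B).
Proof.
apply/idP/idP=> [sB|sB]; last first.
  by rewrite -{1}(permKV g i); apply: (bigcup_sup (g^-1%g i)).
have [a ai] := block_n0 i; have /bigcupP[j jB aj] := subsetP sB a ai.
by rewrite (mem_block ai aj) permK.
Qed.

Lemma pushM g h B : push h (push g B) = push (g * h) B.
Proof.
apply/setP=> a; apply/bigcupP/bigcupP=> -[i]; last first.
  by move=> iB ai; exists (g i); rewrite ?sub_push ?permK // -permM.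
by rewrite sub_push => iB ai; exists (g^-1%g i); rewrite // permM permKV.
Qed.

Lemma push1 P B : partition P setT -> coarser R P -> B \in P -> push 1 B = B.
Proof.
move=> pP /coarserP RP PB; apply/setP=> a; apply/bigcupP/idP=> [[i /subsetP iB]|aB].
  by rewrite perm1; apply: iB.
have [A RA aA] := partition_ex a (blocksP R).
have [i eA] := ordering_surj r RA; have [C PC sAC] := RP _ RA.
have eBC : B = C by apply: (partition_eq pP _ _ aB) => //; apply: (subsetP sAC).
by exists i; rewrite ?perm1 -eA // eBC.
Qed.

Lemma push_block g i : push g (r i) = r (g i).
Proof.
apply/setP=> a; apply/bigcupP/idP=> [[j sji aj]|ai]; last by exists i.
have [b bj] := block_n0 j.
by rewrite (@mem_block i b j) //; apply: (subsetP sji).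
Qed.

Lemma pushI g A B : push g A :&: push g B = push g (A :&: B).
Proof.
apply/setP=> a; rewrite inE; apply/andP/bigcupP=> [[]|[i]].
  case/bigcupP=> i iA ai /bigcupP[j jB aj]; have := mem_block ai aj.
  by move/perm_inj=> eij; exists i => //; rewrite subsetI iA eij.
by rewrite subsetI => /andP[iA iB] ai; split; apply/bigcupP; exists i.
Qed.

Lemma push0 g : push g set0 = set0.
Proof.
apply/setP=> a; rewrite inE; apply/bigcupP=> -[i].
by rewrite subset0 => /eqP e; have [b] := block_n0 i; rewrite e inE.
Qed.

Lemma gmul_syml g (x : dualsym) : coarser R (gcod x) ->
  gmul (sym_elt g) x = [set (p.1, push g p.2) | p in (x : {set _})].
Proof.
move=> cRx; rewrite /gmul /= gdom_sym join_idl ?gcodP ?blocksP //.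
rewrite /gcod -imset_comp; apply: eq_in_imset => p xp /=; congr pair.
  apply/setP=> a; apply/bigcupP/idP=> [[q /andP[xq sqp] aq]|ap]; last first.
    by exists p; rewrite ?xp /=.
  have [b bq] := partition_n0 (gcodP x) (imset_f snd xq).
  have e2 : q.2 = p.2.
    apply: (partition_eq (gcodP x) _ _ bq); rewrite ?imset_f //.
    exact: (subsetP sqp).
  by rewrite -(block_bij_inj2 (graphP x) xq xp e2).
apply/setP=> a; apply/bigcupP/bigcupP=> [[_ /andP[/imsetP[i _ ->] /= iB] ai]|[i iB ai]].
  by exists i.
by exists (r i, r (g i)) => //; rewrite imset_f.
Qed.

Lemma gmul_symr g (x : dualsym) : gdom x = R ->
  gmul x (sym_elt g) = [set (push g^-1 p.1, p.2) | p in (x : {set _})].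
Proof.
move=> dx; rewrite /gmul /= gcod_sym join_idl ?gdomP ?blocksP //; last first.
  by rewrite dx coarser_refl.
rewrite -dx /gdom -imset_comp; apply: eq_in_imset => p xp /=; congr pair.
  apply/setP=> a; apply/bigcupP/bigcupP=> [[_ /andP[/imsetP[i _ ->] /= iB] ai]|[i iB ai]].
    by exists (g i); rewrite ?permK.
  by exists (r (g^-1%g i), r i) => //; rewrite iB andbT; apply/imsetP; exists (g^-1%g i); rewrite ?permKV.
apply/setP=> a; apply/bigcupP/idP=> [[q /andP[xq sqp] aq]|ap]; last first.
  by exists p; rewrite ?xp /=.
have [b bq] := partition_n0 (gdomP x) (imset_f fst xq).
have e1 : q.1 = p.1.
  apply: (partition_eq (gdomP x) _ _ bq); rewrite ?imset_f //.
  exact: (subsetP sqp).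
by rewrite -(block_bij_inj1 (graphP x) xq xp e1).
Qed.

Lemma gdom_syml g (x : dualsym) : coarser R (gcod x) ->
  gdom (dmul (sym_elt g) x) = gdom x.
Proof. by move=> cx; rewrite /gdom /= gmul_syml // -imset_comp. Qed.

Lemma gcod_syml g (x : dualsym) : coarser R (gcod x) ->
  gcod (dmul (sym_elt g) x) = push g @: gcod x.
Proof. by move=> cx; rewrite /gcod /= gmul_syml // -!imset_comp. Qed.

Lemma coarser_syml g (x : dualsym) : coarser R (gcod x) ->
  coarser R (gcod (dmul (sym_elt g) x)).
Proof.
move=> cx; rewrite gcod_syml //; apply/coarserP=> A RA.
have [i eA] := ordering_surj r RA.
have [B xB sB] := coarserP _ _ cx _ (ordering_mem r (g^-1%g i)).
by exists (push g B); rewrite ?imset_f // eA sub_push.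
Qed.

Lemma gdom_symr g (x : dualsym) : gdom x = R -> gdom (dmul x (sym_elt g)) = R.
Proof.
move=> dx; rewrite /gdom /= gmul_symr // -imset_comp.
have -> : [set (fst \o (fun p => (push g^-1 p.1, p.2))) p | p in (x : {set _})]
          = push g^-1 @: gdom x by rewrite /gdom -imset_comp.
rewrite dx; apply/setP=> A; apply/imsetP/idP=> [[B RB ->]|RA].
  by have [i ->] := ordering_surj r RB; rewrite push_block ordering_mem.
have [i ->] := ordering_surj r RA; exists (r (g i)); rewrite ?ordering_mem //.
by rewrite push_block permK.
Qed.

Lemma gcod_symr g (x : dualsym) : gdom x = R ->
  gcod (dmul x (sym_elt g)) = gcod x.
Proof. by move=> dx; rewrite /gcod /= gmul_symr // -imset_comp. Qed.

Lemma sym1l (x : dualsym) : coarser R (gcod x) -> dmul (sym_elt 1) x = x.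
Proof.
move=> cx; apply: val_inj; rewrite /= gmul_syml // -[RHS]imset_id.
apply: eq_in_imset => -[A B] /= xp; rewrite (push1 (gcodP x) cx) //.
exact: (imset_f snd xp).
Qed.

Lemma symMl g h (x : dualsym) : coarser R (gcod x) ->
  dmul (sym_elt (g * h)) x = dmul (sym_elt h) (dmul (sym_elt g) x).
Proof.
move=> cx; apply: val_inj; rewrite [LHS]gmul_syml // [RHS]gmul_syml ?coarser_syml //.
rewrite [graph (dmul _ _)]gmul_syml //.
by rewrite -imset_comp; apply: eq_imset => p /=; rewrite pushM.
Qed.

Lemma sym1r (x : dualsym) : gdom x = R -> dmul x (sym_elt 1) = x.
Proof.
move=> dx; apply: val_inj; rewrite /= gmul_symr // -[RHS]imset_id.
apply: eq_in_imset => -[A B] /= xp; rewrite invg1 (push1 (gdomP x)) //.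
  by rewrite dx coarser_refl.
exact: (imset_f fst xp).
Qed.

Lemma symMr g h (x : dualsym) : gdom x = R ->
  dmul x (sym_elt (g * h)) = dmul (dmul x (sym_elt h)) (sym_elt g).
Proof.
move=> dx; apply: val_inj; rewrite [LHS]gmul_symr // [RHS]gmul_symr ?gdom_symr //.
rewrite [graph (dmul _ _)]gmul_symr //.
by rewrite -imset_comp; apply: eq_imset => p /=; rewrite pushM invMg.
Qed.

End SymmetricSubgroup.

Lemma symC (R : setpart n) k (r : ordering R k) (T : setpart n) m
    (t : ordering T m) g h (x : dualsym) :
    gdom x = R -> coarser T (gcod x) ->
  dmul (sym_elt t h) (dmul x (sym_elt r g)) =
  dmul (dmul (sym_elt t h) x) (sym_elt r g).
Proof.
move=> dx cx; apply: val_inj; rewrite [LHS]gmul_syml ?gcod_symr // [RHS]gmul_symr ?gdom_syml //.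
rewrite [graph (dmul x _)]gmul_symr // [graph (dmul _ x)]gmul_syml //.
by rewrite -!imset_comp.
Qed.

End DualSymmetricInverse.

Section BasisOfOrbit.
Variables (n : nat) (R S T : setpart n) (k l m : nat).

Definition Lclass (P : setpart n) : {set dualsym n} :=
  [set x : dualsym n | gdom x == P].

Definition Yset : {set dualsym n * dualsym n} :=
  [set p | [&& p.1 \in Lclass R, p.2 \in Lclass S
             & meet (gcod p.1) (gcod p.2) == T]].

Definition incidence (P Q : {set {set 'I_n}}) (a : ordering P k)
    (b : ordering Q l) : 'M[bool]_(k, l) :=
  \matrix_(i, j) (a i :&: b j != set0).

(* When O is stable under row and column permutations, it makes no difference  *)
(* whether a and b are quantified existentially or universally.               *)
Definition YOset (O : {set 'M[bool]_(k, l)}) : {set dualsym n * dualsym n} :=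
  [set p in Yset | [exists a : ordering (gcod p.1) k,
     exists b : ordering (gcod p.2) l, incidence a b \in O]].

Variables (r : ordering R k) (s : ordering S l) (t : ordering T m).
Variable O : {set 'M[bool]_(k, l)}.

Definition Ylact (g : 'S_m) (p : dualsym n * dualsym n) :=
  (dmul (sym_elt t g) p.1, dmul (sym_elt t g) p.2).

Definition Yract (g : 'S_k * 'S_l) (p : dualsym n * dualsym n) :=
  (dmul p.1 (sym_elt r g.1), dmul p.2 (sym_elt s g.2)).

Lemma YsetP (p : dualsym n * dualsym n) : reflect
  [/\ gdom p.1 = R, gdom p.2 = S & meet (gcod p.1) (gcod p.2) = T] (p \in Yset).
Proof.
rewrite !inE; apply: (iffP and3P) => -[].
  by move=> /eqP ? /eqP ? /eqP.
by move=> /eqP ? /eqP ? /eqP.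
Qed.

Lemma meet_coarser (P Q : {set {set 'I_n}}) :
  meet P Q = T -> coarser T P /\ coarser T Q.
Proof.
move=> <-; split; apply/coarserP=> C /imset2P[A B PA]; rewrite inE => /andP[QB _] ->.
  by exists A; rewrite ?subsetIl.
by exists B; rewrite // ?subsetIr.
Qed.

Lemma meet_push g (P Q : {set {set 'I_n}}) :
  meet P Q = T -> meet (push t g @: P) (push t g @: Q) = T.
Proof.
move=> eT; apply/setP=> C; apply/imset2P/idP=> [[A' B' /imsetP[A PA ->]]|TC].
  rewrite inE => /andP[/imsetP[B QB ->]]; rewrite pushI => n0 ->.
  have : A :&: B \in meet P Q.
    apply: imset2_f => //; rewrite inE QB /=.
    by apply: contraNneq n0 => ->; rewrite push0.
  by rewrite eT => /(ordering_surj t)[i ->]; rewrite push_block ordering_mem.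
have [i eC] := ordering_surj t TC.
have : t (g^-1%g i) \in meet P Q by rewrite eT ordering_mem.
case/imset2P=> A B PA; rewrite inE => /andP[QB n0] e.
have eAB : push t g A :&: push t g B = C by rewrite pushI -e push_block permKV.
exists (push t g A) (push t g B) => //; first exact: imset_f.
rewrite inE imset_f //= eAB eC; apply/set0Pn.
exact: block_n0.
Qed.

Lemma push_inj g P : partition P setT -> coarser T P -> {in P &, injective (push t g)}.
Proof.
move=> pP cP A B PA PB /(congr1 (push t g^-1)).
by rewrite !pushM mulgV !(push1 t pP cP).
Qed.

Lemma push_orderingP g P k' (a : ordering P k') :
    partition P setT -> coarser T P ->
  injectiveb [ffun i => push t g (a i)] &&
  ([ffun i => push t g (a i)] @: setT == push t g @: P).
Proof.
move=> pP cP; apply/andP; split.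
  apply/injectiveP=> i j; rewrite !ffunE => /(push_inj pP cP) e.
  by apply: (@ordering_inj _ _ _ a); apply: e; apply: ordering_mem.
have imP := ordering_im a.
apply/eqP; apply: (etrans _ (congr1 (fun X : {set {set 'I_n}} => push t g @: X) imP)).
rewrite -imset_comp.
by apply: eq_imset => i /=; rewrite ffunE.
Qed.

Lemma Ylact_closed g p : p \in YOset O -> Ylact g p \in YOset O.
Proof.
rewrite inE => /andP[Yp /existsP[a /existsP[b Oab]]].
have /YsetP[d1 d2 eT] := Yp; have [c1 c2] := meet_coarser eT.
rewrite inE; apply/andP; split.
  by apply/YsetP; rewrite /= !gdom_syml // !gcod_syml // meet_push.
have ha := push_orderingP g a (gcodP p.1) c1.
have hb := push_orderingP g b (gcodP p.2) c2.
rewrite /= -!gcod_syml // in ha hb.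
apply/existsP; exists (Ordering ha); apply/existsP; exists (Ordering hb).
suff -> : incidence (Ordering ha) (Ordering hb) = incidence a b by [].
apply/matrixP=> i j; rewrite !mxE /= !ffunE pushI.
apply/idP/idP; apply: contraNneq => e; first by rewrite e push0.
have /(congr1 (push t g^-1)) := e; rewrite -pushI push0.
rewrite -pushI !pushM mulgV (push1 t (gcodP p.1) c1 (ordering_mem a i)).
by rewrite (push1 t (gcodP p.2) c2 (ordering_mem b j)) => ->.
Qed.

Lemma Yract_closed g p : p \in YOset O -> Yract g p \in YOset O.
Proof.
rewrite inE => /andP[Yp Hp]; have /YsetP[d1 d2 eT] := Yp.
rewrite inE; apply/andP; split.
  by apply/YsetP; rewrite /= !gdom_symr // !gcod_symr.
by rewrite /= !gcod_symr.
Qed.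

Lemma YO_facts p : p \in YOset O ->
  [/\ gdom p.1 = R, gdom p.2 = S, coarser T (gcod p.1) & coarser T (gcod p.2)].
Proof.
by rewrite inE => /andP[/YsetP[d1 d2 /meet_coarser[c1 c2]] _].
Qed.

Lemma Ylact1 p : p \in YOset O -> Ylact 1 p = p.
Proof. by move=> /YO_facts[_ _ c1 c2]; case: p c1 c2 => x y c1 c2; rewrite /Ylact !sym1l. Qed.

Lemma YlactM g h p : p \in YOset O -> Ylact (g * h) p = Ylact h (Ylact g p).
Proof. by move=> /YO_facts[_ _ c1 c2]; rewrite /Ylact !symMl. Qed.

Lemma Yract1 p : p \in YOset O -> Yract 1%g p = p.
Proof. by move=> /YO_facts[d1 d2 _ _]; case: p d1 d2 => x y d1 d2; rewrite /Yract !sym1r. Qed.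

Lemma YractM g h p : p \in YOset O -> Yract (g * h)%g p = Yract g (Yract h p).
Proof. by move=> /YO_facts[d1 d2 _ _]; rewrite /Yract !symMr. Qed.

Lemma YlractC g h p : p \in YOset O -> Ylact g (Yract h p) = Yract h (Ylact g p).
Proof. by move=> /YO_facts[d1 d2 c1 c2]; rewrite /Ylact /Yract /= !symC. Qed.

End BasisOfOrbit.

(* A basis permuted by G on the left and by K on the right, up to the side     *)
(* conventions above: lact g y stands for g y, and ract h y for y h.           *)
Record biset (gT : finGroupType) (G : {group gT}) (kT : finGroupType)
    (K : {group kT}) (T : finType) := Biset {
  carrier :> {set T};
  lact : gT -> T -> T;
  ract : kT -> T -> T;
  lact_closed : forall g y, g \in G -> y \in carrier -> lact g y \in carrier;
  ract_closed : forall h y, h \in K -> y \in carrier -> ract h y \in carrier;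
  lact1 : forall y, y \in carrier -> lact 1%g y = y;
  ract1 : forall y, y \in carrier -> ract 1%g y = y;
  lactM : forall g g' y, g \in G -> g' \in G -> y \in carrier ->
    lact (g * g')%g y = lact g' (lact g y);
  ractM : forall h h' y, h \in K -> h' \in K -> y \in carrier ->
    ract (h * h')%g y = ract h (ract h' y);
  lractC : forall g h y, g \in G -> h \in K -> y \in carrier ->
    lact g (ract h y) = ract h (lact g y) }.

Definition YObiset n (R S T : setpart n) k l m (r : ordering R k)
    (s : ordering S l) (t : ordering T m) (O : {set 'M[bool]_(k, l)}) :
    biset [set: 'S_m] [set: 'S_k * 'S_l] (dualsym n * dualsym n)%type :=
  @Biset _ [set: 'S_m] _ [set: 'S_k * 'S_l] _ (YOset R S T O) (Ylact t) (Yract r s)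
    (fun g y _ => @Ylact_closed n R S T k l m t O g y)
    (fun h y _ => @Yract_closed n R S T k l r s O h y)
    (@Ylact1 n R S T k l m t O) (@Yract1 n R S T k l r s O)
    (fun g g' y _ _ => @YlactM n R S T k l m t O g g' y)
    (fun h h' y _ _ => @YractM n R S T k l r s O h h' y)
    (fun g h y _ _ => @YlractC n R S T k l m r s t O g h y).

(* The (G, H)-biset G, where H acts through f. *)
Section RegularBiset.
Variables (gT hT : finGroupType) (G : {group gT}) (H : {group hT}).
Variables (f : {morphism H >-> gT}) (sfHG : f @* H \subset G).

Let fG h : h \in H -> f h \in G.
Proof. by move=> Hh; apply: (subsetP sfHG); apply: mem_morphim. Qed.

Fact reg_lact_closed g y : g \in G -> y \in G -> (y * g)%g \in G.
Proof. by move=> Gg Gy; rewrite groupM. Qed.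
Fact reg_ract_closed h y : h \in H -> y \in G -> (f h * y)%g \in G.
Proof. by move=> Hh Gy; rewrite groupM ?fG. Qed.
Fact reg_lact1 (y : gT) : y \in G -> (y * 1)%g = y.
Proof. by rewrite mulg1. Qed.
Fact reg_ract1 y : y \in G -> (f 1 * y)%g = y.
Proof. by rewrite morph1 mul1g. Qed.
Fact reg_lactM g g' y : g \in G -> g' \in G -> y \in G ->
  (y * (g * g') = y * g * g')%g.
Proof. by rewrite mulgA. Qed.
Fact reg_ractM h h' y : h \in H -> h' \in H -> y \in G ->
  (f (h * h') * y = f h * (f h' * y))%g.
Proof. by move=> Hh Hh' _; rewrite morphM // mulgA. Qed.
Fact reg_lractC g h (y : gT) : g \in G -> h \in H -> y \in G ->
  (f h * y * g = f h * (y * g))%g.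
Proof. by rewrite mulgA. Qed.

Definition reg_biset : biset G H gT :=
  Biset reg_lact_closed reg_ract_closed reg_lact1 reg_ract1
    reg_lactM reg_ractM reg_lractC.

End RegularBiset.

Section PermutationMatrix.
Variables (F : fieldType) (T : finType) (Y : {set T}).

Definition basis_row (y : T) : 'rV[F]_#|Y| := \row_j (y == enum_val j)%:R.

Definition fun_mx (f : T -> T) : 'M[F]_#|Y| :=
  \matrix_i basis_row (f (enum_val i)).

Lemma basis_row_mul y f : y \in Y -> basis_row y *m fun_mx f = basis_row (f y).
Proof.
move=> Yy; apply/rowP=> j; rewrite !mxE (bigD1 (enum_rank_in Yy y)) //=.
rewrite !mxE enum_rankK_in // eqxx mul1r big1 ?addr0 // => i ne.
rewrite !mxE; case: eqP => [e|]; last by rewrite mul0r.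
by case/eqP: ne; apply: enum_val_inj; rewrite enum_rankK_in.
Qed.

Lemma fun_mxM f g : (forall y, y \in Y -> f y \in Y) ->
  fun_mx f *m fun_mx g = fun_mx (g \o f).
Proof.
move=> fY; apply/row_matrixP=> i.
by rewrite row_mul !rowK basis_row_mul //; apply/fY/enum_valP.
Qed.

Lemma eq_fun_mx f g : {in Y, f =1 g} -> fun_mx f = fun_mx g.
Proof. by move=> efg; apply/row_matrixP=> i; rewrite !rowK efg ?enum_valP. Qed.

Lemma fun_mx1 f : {in Y, f =1 id} -> fun_mx f = 1%:M.
Proof.
move=> f1; apply/matrixP=> i j; rewrite !mxE f1 ?enum_valP //.
by rewrite (inj_eq enum_val_inj).
Qed.

End PermutationMatrix.

Section Bimodules.
Variable F : fieldType.

(* bimod_mx h is the matrix, acting on row vectors, of u |-> u h. *)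
Record bimodule (gT : finGroupType) (G : {group gT}) (kT : finGroupType)
    (K : {group kT}) (N : nat) := Bimodule {
  bimod_repr : mx_representation F G N;
  bimod_mx : kT -> 'M[F]_N;
  bimod_mx1 : bimod_mx 1%g = 1%:M;
  bimod_mxM : {in K &, forall h h', bimod_mx (h * h')%g = bimod_mx h' *m bimod_mx h};
  bimod_mxC : {in G & K, forall g h,
    bimod_repr g *m bimod_mx h = bimod_mx h *m bimod_repr g} }.

Section OfBiset.
Variables (gT kT : finGroupType) (G : {group gT}) (K : {group kT}).
Variables (T : finType) (Y : biset G K T).

Lemma biset_mx_repr : mx_repr G (fun g => fun_mx F Y (lact Y g)).
Proof.
split=> [|g h Gg Gh]; first by apply: fun_mx1 => y; apply: lact1.
rewrite fun_mxM => [|y Yy]; last exact: lact_closed.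
by apply: eq_fun_mx => y Yy; apply: lactM.
Qed.

Lemma biset_mx1 : fun_mx F Y (ract Y 1) = 1%:M.
Proof. by apply: fun_mx1 => y; apply: ract1. Qed.

Lemma biset_mxM : {in K &, forall h h',
  fun_mx F Y (ract Y (h * h')) = fun_mx F Y (ract Y h') *m fun_mx F Y (ract Y h)}.
Proof.
move=> h h' Kh Kh'; rewrite fun_mxM => [|y Yy]; last exact: ract_closed.
by apply: eq_fun_mx => y Yy; apply: ractM.
Qed.

Lemma biset_mxC : {in G & K, forall g h,
  MxRepresentation biset_mx_repr g *m fun_mx F Y (ract Y h) =
  fun_mx F Y (ract Y h) *m MxRepresentation biset_mx_repr g}.
Proof.
move=> g h Gg Kh /=; rewrite !fun_mxM => [|y Yy|y Yy].
- by apply: eq_fun_mx => y Yy /=; rewrite lractC.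
- exact: lact_closed.
exact: ract_closed.
Qed.

Definition biset_bimodule : bimodule G K #|Y| :=
  Bimodule biset_mx1 biset_mxM biset_mxC.

End OfBiset.

Section TensorOver.
Variables (gT kT : finGroupType) (G : {group gT}) (K : {group kT}) (N d : nat).
Variables (U : bimodule G K N) (W : mx_representation F K d).

Lemma tensor_mx_repr :
  mx_repr G (fun g => tprod (bimod_repr U g) (1%:M : 'M[F]_d)).
Proof.
split=> [|g h Gg Gh]; first by rewrite repr_mx1 tprod1.
by rewrite repr_mxM // -tprodE mulmx1.
Qed.

Definition tensor_repr := MxRepresentation tensor_mx_repr.

(* The row space spanned by all (u h) (x) w - u (x) (h w). *)
Definition balanced_mx : 'M[F]_(N * d) :=
  (\sum_(h in K) <<tprod (bimod_mx U h) 1%:M - tprod 1%:M (W h)>>)%MS.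

Lemma balanced_module : mxmodule tensor_repr balanced_mx.
Proof.
apply: sumsmx_module => h Kh; rewrite (eqmx_module _ (genmxE _)).
apply/mxmoduleP=> g Gg /=; rewrite mulmxBl -!tprodE !mul1mx !mulmx1.
rewrite -bimod_mxC // -[bimod_repr U g in X in _ - X]mulmx1.
by rewrite -[W h in X in (X <= _)%MS]mul1mx -[1%:M in X in X - _]mul1mx !tprodE -mulmxBr submxMl.
Qed.

(* U (x)_{F[K]} W, as the quotient of U (x)_F W. *)
Definition tensor_over := factmod_repr balanced_module.

End TensorOver.

(* F[G] (x)_{F[H]} W, where H acts on F[G] through f; for an injective f this  *)
(* is the induction from H, regarded as a subgroup of G.                      *)
Definition induced (gT hT : finGroupType) (G : {group gT}) (H : {group hT})
    (f : {morphism H >-> gT}) (sfHG : f @* H \subset G)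
    d (W : mx_representation F H d) :=
  tensor_over (biset_bimodule (reg_biset sfHG)) W.

Section OuterTensor.
Variables (gT hT : finGroupType) (d e : nat).
Variables (V : mx_representation F [set: gT] d).
Variables (W : mx_representation F [set: hT] e).

Lemma outer_mx_repr :
  mx_repr [set: gT * hT] (fun g => tprod (V g.1) (W g.2)).
Proof.
split=> [|g h _ _]; first by rewrite !repr_mx1 tprod1.
by rewrite /= !repr_mxM ?inE // tprodE.
Qed.

Definition outer_tensor : mx_representation F [set: gT * hT] (d * e) :=
  MxRepresentation outer_mx_repr.
End OuterTensor.

End Bimodules.

(* [V : S] for S simple and V semisimple: the multiplicity of the component of *)
(* the socle of V whose simple constituent is isomorphic to S, and 0 if there  *)
(* is none.                                                                   *)
Definition multiplicity (F : decFieldType) (gT : finGroupType) (G : {group gT})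
    d (V : mx_representation F G d) e (S : mx_representation F G e) : nat :=
  (\sum_(W : DecSocleType V | `[< mx_rsim (socle_repr W) S >]) socle_mult W)%N.

Section Specht.
Variables (F : fieldType) (k : nat).

Definition integer_partition (la : seq nat) : bool :=
  [&& sorted geq la, all (fun a => 0 < a)%N la & sumn la == k].

Variable la : seq nat.
Implicit Types t p g : 'S_k.

(* The cells of the diagram of la are numbered by 'I_k, row after row; a       *)
(* tableau is a permutation t sending the number of each cell to its entry.    *)
(* row_of t x and col_of t x locate the entry x in t.                         *)
Definition row_of t (x : 'I_k) := reshape_index la (t^-1%g x).
Definition col_of t (x : 'I_k) := reshape_offset la (t^-1%g x).

(* Row equivalence class of t. *)
Definition tabloid t : {set 'S_k} :=
  [set t' | [forall x, row_of t' x == row_of t x]].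

Definition tabloids : {set {set 'S_k}} := [set tabloid t | t : 'S_k].

Definition tabloid_act g (X : {set 'S_k}) : {set 'S_k} :=
  [set (t * g)%g | t in X].

Definition column_stab t : {set 'S_k} :=
  [set p : 'S_k | [forall x, col_of t (p x) == col_of t x]].

Lemma row_ofM t g x : row_of (t * g) x = row_of t (g^-1%g x).
Proof. by rewrite /row_of invMg permM. Qed.

Lemma col_ofM t g x : col_of (t * g) x = col_of t (g^-1%g x).
Proof. by rewrite /col_of invMg permM. Qed.

Lemma tabloid_actE g t : tabloid_act g (tabloid t) = tabloid (t * g).
Proof.
apply/setP=> u; apply/imsetP/idP => [[t' ] |].
  rewrite !inE => /forallP tt' ->; apply/forallP=> x.
  by rewrite !row_ofM.
rewrite inE => /forallP ut; exists (u * g^-1)%g; last by rewrite mulgKV.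
rewrite inE; apply/forallP=> x; have /eqP := ut (g x).
by rewrite row_ofM permK => <-; rewrite row_ofM invgK.
Qed.

Lemma tabloid_mem t : tabloid t \in tabloids.
Proof. exact: imset_f. Qed.

Lemma tabloid_act_closed g X : X \in tabloids -> tabloid_act g X \in tabloids.
Proof. by case/imsetP=> t _ ->; rewrite tabloid_actE tabloid_mem. Qed.

Lemma tabloid_mx_repr :
  mx_repr [set: 'S_k] (fun g => fun_mx F tabloids (tabloid_act g)).
Proof.
split=> [|g h _ _].
  by apply: fun_mx1 => _ /imsetP[t _ ->]; rewrite tabloid_actE mulg1.
rewrite fun_mxM; last exact: tabloid_act_closed.
by apply: eq_fun_mx => _ /imsetP[t _ ->]; rewrite /= !tabloid_actE mulgA.
Qed.

Definition tabloid_repr := MxRepresentation tabloid_mx_repr.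

(* The tableau obtained by applying p to the entries of t is t * p. *)
Definition polytabloid t : 'rV[F]_#|tabloids| :=
  \sum_(p in column_stab t) (-1) ^+ p *: basis_row F tabloids (tabloid (t * p)).

Definition specht_mx : 'M[F]_#|tabloids| := (\sum_(t : 'S_k) <<polytabloid t>>)%MS.

Lemma polytabloidM t g :
  polytabloid t *m tabloid_repr g = polytabloid (t * g).
Proof.
rewrite mulmx_suml [RHS](reindex_inj (conjg_inj g)) /=.
apply: eq_big => [p|p _].
  rewrite !inE; apply/forallP/forallP=> H x; last first.
    by have := H (g x); rewrite !col_ofM conjgE !permM !permK.
  by have := H (g^-1%g x); rewrite !col_ofM conjgE !permM permK.
rewrite -scalemxAl basis_row_mul ?tabloid_mem // tabloid_actE odd_permJ.
by rewrite conjgE !mulgA mulgK.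
Qed.

Lemma specht_module : mxmodule tabloid_repr specht_mx.
Proof.
apply/mxmoduleP=> g Gg; rewrite sumsmxMr_gen; apply/sumsmx_subP=> t _.
rewrite genmxE (eqmxMr _ (genmxE _)) polytabloidM.
by apply: (submx_trans _ (sumsmx_sup (t * g)%g _ (submx_refl _))); rewrite ?genmxE.
Qed.

Definition specht : mx_representation F [set: 'S_k] (\rank specht_mx) :=
  submod_repr specht_module.

End Specht.

Section ZeroOneMatrices.
Variables k l : nat.
Implicit Types (M : 'M[bool]_(k, l)) (g : 'S_k * 'S_l).

(* 0/1-matrices are Boolean matrices. *)
Definition ones M : {set 'I_k * 'I_l} := [set e | M e.1 e.2].

Definition Qset (m : nat) : {set 'M[bool]_(k, l)} :=
  [set M | [&& #|ones M| == m, [forall i, exists j, M i j]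
             & [forall j, exists i, M i j]]].

Definition entry_act g (e : 'I_k * 'I_l) := (g.1 e.1, g.2 e.2).

Definition mx_act M g : 'M[bool]_(k, l) :=
  \matrix_(i, j) M (g.1^-1%g i) (g.2^-1%g j).

Fact mx_act1 M : mx_act M 1%g = M.
Proof. by apply/matrixP=> i j; rewrite !mxE /= !invg1 !perm1. Qed.

Fact mx_actM M : act_morph mx_act M.
Proof. by move=> g h; apply/matrixP=> i j; rewrite !mxE /= !invMg !permM. Qed.

Canonical mx_action := TotalAction mx_act1 mx_actM.

Definition mx_stab M : {group 'S_k * 'S_l} := 'C[M | mx_action]%G.

Lemma mx_stabP M g : g \in mx_stab M -> forall e, (entry_act g e \in ones M) = (e \in ones M).
Proof.
move=> Hg e; rewrite !inE /=.
have {1}<- : mx_act M g = M by apply: (astab1P Hg).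
by rewrite mxE !permK.
Qed.

Section EntryPermutation.
Variables (m : nat) (M : 'M[bool]_(k, l)) (b : ordering (ones M) m).

(* The permutation of 'I_m induced, through b, by g acting on the entries      *)
(* of M equal to 1; it is characterised by ones_permE for g in the stabilizer. *)
Definition ones_perm g : 'S_m :=
  odflt 1%g [pick s : 'S_m | [forall x, b (s x) == entry_act g (b x)]].

Lemma ones_permE g : g \in mx_stab M -> forall x, b (ones_perm g x) = entry_act g (b x).
Proof.
move=> Hg x; rewrite /ones_perm; case: pickP => [s /forallP/(_ x)/eqP // | no].
have ex y : {z | b z == entry_act g (b y)}.
  apply: sigW; have : entry_act g (b y) \in ones M by rewrite (mx_stabP Hg) ordering_mem.
  by case/(ordering_surj b)=> z ->; exists z.
have inj : injective (fun y => sval (ex y)).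
  move=> y z e; apply: (@ordering_inj _ _ _ b).
  have := eqP (svalP (ex y)); rewrite e (eqP (svalP (ex z))).
  by case=> /perm_inj e1 /perm_inj e2; apply/esym/eqP/andP; rewrite e1 e2.
have := no (perm inj); case/negP/negP/forallP=> y.
by rewrite permE (svalP (ex y)).
Qed.

Lemma ones_permM : {in mx_stab M &, {morph ones_perm : g h / (g * h)%g}}.
Proof.
move=> g h Hg Hh; apply/permP=> x; apply: (@ordering_inj _ _ _ b).
rewrite permM !ones_permE ?groupM //.
by rewrite /entry_act /= !permM.
Qed.

Canonical ones_morphism := Morphism ones_permM.

Lemma ones_perm_injm : M \in Qset m -> 'injm ones_perm.
Proof.
rewrite inE => /and3P[_ /'forall_existsP rowM /'forall_existsP colM].
have fixM g : g \in mx_stab M -> ones_perm g = 1%g ->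
    forall e, M e.1 e.2 -> entry_act g e = e.
  move=> Hg g1 e Me; have : e \in ones M by rewrite inE.
  by case/(ordering_surj b)=> x ->; rewrite -ones_permE // g1 perm1.
apply/subsetP=> g /setIP[Hg]; rewrite inE => /set1P g1.
case: g Hg g1 => g h Hg g1.
suff [-> ->] : g = 1%g /\ h = 1%g by apply: set11.
split; apply/permP=> i; rewrite perm1.
  by have [j Mij] := rowM i; have [] := fixM _ Hg g1 (i, j) Mij.
by have [j Mij] := colM i; have [] := fixM _ Hg g1 (j, i) Mij.
Qed.

End EntryPermutation.
End ZeroOneMatrices.

(* Main.v *)
Require Import Defs.
From mathcomp Require Import all_boot all_order all_algebra all_fingroup.
From mathcomp Require Import all_solvable all_field all_character.
From mathcomp Require Import boolp.
Set Implicit Arguments.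
Unset Strict Implicit.
Unset Printing Implicit Defensive.
Import GroupScope GRing.Theory.
Local Open Scope ring_scope.

(** The two modules are isomorphic, so every multiplicity agrees.

    Recording for each pair in the basis which parts of its two codomains meet,
    and which part of tau each non-empty intersection is, identifies the basis
    with the set of pairs (N, beta), where N lies in O and beta is a bijection
    from the entries of N equal to 1 to the parts of tau (cell, cell_ext and
    cell_mx_YO). Here S_m acts by permuting the parts of tau and S_k x S_l by
    permuting rows and columns, and the two actions together are transitive.
    For the point y0 = (M, b) (base_pair), an element h of S_k x S_l moves y0
    within its S_m-orbit exactly when h fixes M, and then y0 h = (f h) y0, where
    f h is the permutation of the entries of M induced by h; moreover S_m acts
    freely on y0 (ract_base_pair, stab_base_pair, trans_base_pair). So the basis
    is the balanced product of S_m and S_k x S_l over H.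

    For any such biset Y, mapping g (x) w to g y0 (x) w identifies
    F[G] (x)_{F[H]} W with F[Y] (x)_{F[K]} W (tensor_over_induced_rsim). Both
    sides are defined as quotients of tensor products over F, and the inverse
    isomorphism involves choosing for each y an expression g y0 h, so the maps
    are compared modulo the balancing relations (factmod_rsim).

    Finally the multiplicity of a module S in V is read off from a component of
    the socle of V, and depends only on the isomorphism class of V
    (multiplicity_rsim). *)

(** * Multiplicities of isomorphic modules *)

Section SimilarRepresentations.
Variables (F : decFieldType) (gT : finGroupType) (G : {group gT}).

(** Inside the socle, the simple submodules isomorphic to S make up a single
    component, so any one of them computes the multiplicity. *)
Lemma multiplicity_component d (V : mx_representation F G d) e
    (S : mx_representation F G e) (U : 'M_d) (modU : mxmodule V U) :
    mxsimple V U -> mx_rsim (submod_repr modU) S ->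
  multiplicity V S = (\rank (component_mx V U) %/ \rank U)%N.
Proof.
move=> simU simUS; have [W0 isoWU] := Socle_iso (DecSocleType V) simU.
have simW := @socle_simple _ _ _ _ _ (DecSocleType V).
have simW0S : mx_rsim (socle_repr W0) S.
  by apply: mx_rsim_trans simUS; apply/mx_rsim_iso.
rewrite /multiplicity (big_pred1 W0) => [|W /=]; last first.
  apply/asboolP/socle_rsimP => [simWS|simWW0].
    exact: mx_rsim_trans simWS (mx_rsim_sym simW0S).
  exact: mx_rsim_trans simWW0 simW0S.
rewrite /socle_mult; congr (_ %/ _)%N.
  by have /component_mx_isoP/eqP <- := isoWU.
by case: isoWU => f injf _ <-; rewrite mxrankMfree ?row_free_unit.
Qed.

(** An invertible intertwiner B carries the submodule lattice of V1 to that of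
    V2, preserving simplicity, isomorphism types and components. *)
Section Transport.
Variables (d : nat) (V1 V2 : mx_representation F G d) (B : 'M[F]_d).
Hypothesis unitB : B \in unitmx.
Hypothesis homB : forall x, x \in G -> V1 x *m B = B *m V2 x.

Lemma transport_mxmodule (U : 'M_d) : mxmodule V1 U -> mxmodule V2 (U *m B).
Proof.
move=> /mxmoduleP modU; apply/mxmoduleP=> x Gx.
by rewrite -mulmxA -homB // mulmxA submxMr ?modU.
Qed.

Lemma transport_mx_iso (U W : 'M_d) : mx_iso V1 U W -> mx_iso V2 (U *m B) (W *m B).
Proof.
case=> f unitf /hom_mxP homf defW.
exists (invmx B *m f *m B); first by rewrite !unitmx_mul unitmx_inv unitB unitf.
  apply/hom_mxP=> x Gx; rewrite !mulmxA mulmxK // -(mulmxA _ B) -homB // mulmxA.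
  by rewrite mulmxK // homf // -(mulmxA _ B) -homB // !mulmxA.
by rewrite !mulmxA mulmxK //; apply: eqmxMr.
Qed.

Lemma transport_rsim (U : 'M_d) (modU : mxmodule V1 U)
    (modUB : mxmodule V2 (U *m B)) :
  mx_rsim (submod_repr modU) (submod_repr modUB).
Proof.
exists (in_submod (U *m B) (val_submod 1%:M *m B)) => [||x Gx].
- by rewrite mxrankMfree ?row_free_unit.
- rewrite /row_free mxrank_in_submod ?submxMr ?val_submodP //.
  by rewrite mxrankMfree ?row_free_unit // val_submod1.
rewrite -in_submodJ ?submxMr ?val_submodP // -(mulmxA _ B) -homB // (mulmxA _ _ B).
rewrite -(val_submodJ modU) // mul1mx.
rewrite (val_submodE (submod_mx modU x)) -[in RHS](mulmxA _ _ B).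
exact: mulmxA.
Qed.
Lemma transport_mxsimple (U : 'M_d) : mxsimple V1 U -> mxsimple V2 (U *m B).
Proof.
move=> simU; have modU := mxsimple_module simU.
have modUB := transport_mxmodule modU.
apply/(submod_mx_irr modUB); apply: mx_rsim_irr (transport_rsim modU modUB) _.
exact/submod_mx_irr.
Qed.

Lemma transport_component (U : 'M_d) : mxsimple V1 U ->
  (component_mx V1 U *m B <= component_mx V2 (U *m B))%MS.
Proof.
move=> simU; have [I [W isoUW ->]] := component_mx_def simU.
rewrite sumsmxMr; apply/sumsmx_subP=> i _; apply: mx_iso_component.
  exact: transport_mxsimple.
exact: transport_mx_iso.
Qed.
End Transport.

(** The components of the two socles correspond under the intertwiner and have
    equal rank; applying the transport lemmas to B and to its inverse gives
    the two inequalities between ranks, and shows that S occurs in V2 only if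
    it occurs in V1. *)
Lemma multiplicity_rsim d1 d2 (V1 : mx_representation F G d1)
    (V2 : mx_representation F G d2) e (S : mx_representation F G e) :
  mx_rsim V1 V2 -> multiplicity V1 S = multiplicity V2 S.
Proof.
case=> B def2; case: _ / def2 in V2 B * => freeB homB.
have unitB : B \in unitmx by rewrite -row_free_unit.
have homB' x : x \in G -> V2 x *m invmx B = invmx B *m V1 x.
  move=> Gx; rewrite -[in LHS](mulKmx unitB (V2 x)) -homB //.
  by rewrite -!mulmxA mulmxV // mulmx1.
have unitB' : invmx B \in unitmx by rewrite unitmx_inv.
pose isS (W : DecSocleType V1) := `[< mx_rsim (socle_repr W) S >].
case: (pickP isS) => [W /asboolP simWS|no1].
  have simU := socle_simple W; set U := socle_base W in simU.
  have simUB := transport_mxsimple unitB homB simU.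
  rewrite (multiplicity_component simU simWS).
  rewrite (@multiplicity_component _ _ _ _ _ (mxsimple_module simUB)) //; last first.
    by apply: mx_rsim_trans simWS; apply/mx_rsim_sym/transport_rsim.
  rewrite [\rank (U *m B)]mxrankMfree ?row_free_unit //; congr (_ %/ _)%N.
  apply/eqP; rewrite eqn_leq; apply/andP; split.
    rewrite -(@mxrankMfree _ _ _ _ (component_mx V1 U) B) ?row_free_unit //.
    exact/mxrankS/transport_component.
  have := mxrankS (transport_component unitB' homB' simUB).
  by rewrite mulmxK // mxrankMfree ?row_free_unit.
rewrite /multiplicity (big_pred0 _ _ _ _ no1) big_pred0 // => W.
apply/asboolP=> simWS.
have simU := transport_mxsimple unitB' homB' (socle_simple W).
have [W1 isoW1] := Socle_iso (DecSocleType V1) simU.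
have /asboolP[] := no1 W1; apply: mx_rsim_trans simWS.
apply: (@mx_rsim_trans _ _ _ _ _ _ _ (submod_repr (mxsimple_module simU))).
  exact/mx_rsim_iso.
exact/mx_rsim_sym/transport_rsim.
Qed.

End SimilarRepresentations.

(** * Tensor products over a group algebra *)

Section TensorProducts.
Variable F : fieldType.

Lemma trowDl n1 (A A' : 'rV[F]_n1) m2 n2 (B : 'M[F]_(m2, n2)) :
  trow (A + A') B = trow A B + trow A' B.
Proof.
elim: n1 A A' => [|n1 IHn] A A' /=; first by rewrite addr0.
rewrite (linearD (@rsubmx _ 1 1 n1)) IHn (linearD (@lsubmx _ 1 1 n1)).
by rewrite mxE scalerDl add_row_mx.
Qed.

Lemma tprodDl m1 n1 (A A' : 'M[F]_(m1, n1)) m2 n2 (B : 'M[F]_(m2, n2)) :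
  tprod (A + A') B = tprod A B + tprod A' B.
Proof.
elim: m1 A A' => [|m1 IHm] A A' /=; first by rewrite addr0.
rewrite (linearD (@dsubmx _ 1 m1 n1)) IHm (linearD (@usubmx _ 1 m1 n1)).
by rewrite trowDl add_col_mx.
Qed.

Lemma tprod0l m1 n1 m2 n2 (B : 'M[F]_(m2, n2)) : tprod (0 : 'M_(m1, n1)) B = 0.
Proof. by apply: (addrI (tprod 0 B)); rewrite -tprodDl !addr0. Qed.

Lemma tprod_suml (I : finType) m1 n1 (A : I -> 'M[F]_(m1, n1)) m2 n2
    (B : 'M[F]_(m2, n2)) :
  tprod (\sum_i A i) B = \sum_i tprod (A i) B.
Proof.
pose tprodB (A1 : 'M[F]_(m1, n1)) := tprod A1 B.
exact: (big_morph tprodB (fun A1 A2 => tprodDl A1 A2 B) (tprod0l _ _ B)).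
Qed.

(** The blocks of rows (row i 1) (x) 1 exhaust the rows of F^N (x) F^d, because
    the identity matrix is the sum of its (row i 1)^T *m row i 1. *)
Lemma sub_tprod_rows N d p (X : 'M[F]_(N * d, p)) q (U : 'M_(q, p)) :
    (forall i, (tprod (row i (1%:M : 'M[F]_N)) (1%:M : 'M[F]_d) *m X <= U)%MS) ->
  (X <= U)%MS.
Proof.
move=> subXU; rewrite -[X]mul1mx -tprod1.
have -> : 1%:M = \sum_i (row i 1%:M)^T *m row i 1%:M :> 'M[F]_N.
  apply/matrixP=> i j; rewrite summxE (bigD1 i) //= big1 ?addr0 => [|h nih].
    by rewrite !mxE big_ord1 !mxE eqxx mul1r.
  by rewrite !mxE big_ord1 !mxE (negbTE nih) mul0r.
rewrite tprod_suml mulmx_suml summx_sub // => i _.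
by rewrite -[X in tprod _ X]mulmx1 tprodE -mulmxA mulmx_sub.
Qed.

(** Two maps between V1 and V2 that respect the submodules U1 and U2, and are
    mutually inverse modulo them, induce mutually inverse maps between the
    quotients. Only A has to be equivariant: the inverse then is as well, so
    B may be built from arbitrary choices. *)
Lemma factmod_rsim (gT : finGroupType) (G : {group gT}) N1 N2
    (V1 : mx_representation F G N1) (V2 : mx_representation F G N2)
    (U1 : 'M_N1) (U2 : 'M_N2) (modU1 : mxmodule V1 U1) (modU2 : mxmodule V2 U2)
    (A : 'M_(N1, N2)) (B : 'M_(N2, N1)) :
    (forall g, g \in G -> V1 g *m A = A *m V2 g) ->
    (U1 *m A <= U2)%MS -> (U2 *m B <= U1)%MS ->
    (A *m B - 1%:M <= U1)%MS -> (B *m A - 1%:M <= U2)%MS ->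
  mx_rsim (factmod_repr modU1) (factmod_repr modU2).
Proof.
have in_eq n p (W W' : 'M[F]_(p, n)) (U0 : 'M[F]_n) :
    (W - W' <= U0)%MS -> in_factmod U0 W = in_factmod U0 W'.
  by move=> sub; apply/eqP; rewrite -subr_eq0 -linearB in_factmod_eq0.
(* q W1 W2 C is the map from the quotient by W1 to the quotient by W2 that C *)
(* induces.                                                                  *)
pose q n1 n2 (W1 : 'M[F]_n1) (W2 : 'M[F]_n2) (C : 'M_(n1, n2)) :=
  in_factmod W2 (val_factmod (1%:M : 'M_(\rank (cokermx W1))) *m C).
move=> homA UA UB AB BA.
have val_in n1 n2 (W1 : 'M[F]_n1) (W2 : 'M[F]_n2) p (C : 'M_(n1, n2))
    (X : 'M_(p, n1)) : (W1 *m C <= W2)%MS ->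
    in_factmod W2 (val_factmod (in_factmod W1 X) *m C) = in_factmod W2 (X *m C).
  move=> WC; apply: in_eq; rewrite -mulmxBl (submx_trans _ WC) // submxMr //.
  by rewrite -in_factmod_eq0 linearB /= val_factmodK subrr.
have qq n1 n2 (W1 : 'M[F]_n1) (W2 : 'M[F]_n2) C D : (W2 *m D <= W1)%MS ->
    (C *m D - 1%:M <= W1)%MS -> q _ _ W1 W2 C *m q _ _ W2 W1 D = 1%:M.
  move=> WD CD; rewrite /q [in_factmod W1 _]in_factmodE mulmxA.
  rewrite (mulmxA (in_factmod _ _)) -val_factmodE -in_factmodE.
  rewrite val_in // -[RHS]val_factmodK; apply: in_eq.
  by rewrite -mulmxA -[X in _ - X]mulmx1 -mulmxBr mulmx_sub.
have q12 := qq _ _ _ _ _ _ UB AB; have q21 := qq _ _ _ _ _ _ UA BA.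
have [le1 le2] := (mulmx1_min q12, mulmx1_min q21).
exists (q _ _ U1 U2 A) => [||g Gg].
- by apply/eqP; rewrite eqn_leq le1.
- by apply/row_freeP; exists (q _ _ U2 U1 B).
rewrite -[RHS](in_factmodJ modU2) // -(mulmxA _ A) -homA // mulmxA.
rewrite -[RHS](val_in _ _ U1 U2) // val_factmodE -(mulmxA _ _ A).
exact: mulmxA.
Qed.

Section TensorOfBiset.
Variables (gT kT : finGroupType) (G : {group gT}) (K : {group kT}).
Variables (T : finType) (Y : biset G K T).
Variables (d : nat) (W : mx_representation F K d).

(** The block of p rows y (x) w, for w ranging over the rows of D. Taking D = 1
    treats all the vectors w at once, and a matrix D = W h records the action
    of h on them. *)
Definition simple_tensor p (y : T) (D : 'M[F]_(p, d)) : 'M[F]_(1 * p, #|Y| * d) :=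
  tprod (basis_row F Y y) D.

Definition balanced := balanced_mx (biset_bimodule F Y) W.

Lemma simple_tensor_balanced p y h (D : 'M[F]_(p, d)) : y \in carrier Y -> h \in K ->
  (simple_tensor (Defs.ract Y h y) D - simple_tensor y (D *m W h)
     <= balanced)%MS.
Proof.
move=> Yy Kh; rewrite /simple_tensor -(basis_row_mul F (Defs.ract Y h) Yy).
rewrite -[D in tprod _ D]mulmx1 -[basis_row F Y y in X in _ - X]mulmx1.
rewrite !tprodE -mulmxBr.
by apply: mulmx_sub; rewrite (sumsmx_sup h) // genmxE.
Qed.

Lemma row1_tr (i j : 'I_#|Y|) :
  row i 1%:M *m (row j 1%:M)^T = (i == j)%:R%:M :> 'M[F]_1.
Proof.
apply/rowP=> z; rewrite !ord1 !mxE (bigD1 j) //= big1 ?addr0 => [|h njh].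
  by rewrite !mxE eqxx mulr1 mulr1n.
by rewrite !mxE [j == h]eq_sym (negbTE njh) mulr0.
Qed.

Lemma row1_basis (i : 'I_#|Y|) : row i 1%:M = basis_row F Y (enum_val i).
Proof. by apply/rowP=> j; rewrite !mxE (inj_eq enum_val_inj). Qed.

Lemma sub_simple_tensors p (X : 'M[F]_(#|Y| * d, p)) q (U : 'M_(q, p)) :
    (forall y, y \in carrier Y -> (simple_tensor y 1%:M *m X <= U)%MS) ->
  (X <= U)%MS.
Proof.
move=> subXU; apply: sub_tprod_rows => i; rewrite row1_basis.
exact/subXU/enum_valP.
Qed.

Lemma balanced_mulmx p (X : 'M[F]_(#|Y| * d, p)) q (U : 'M_(q, p)) :
    (forall y h, y \in carrier Y -> h \in K ->
      (simple_tensor (Defs.ract Y h y) 1%:M *m X - simple_tensor y (W h) *m X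
         <= U)%MS) ->
  (balanced *m X <= U)%MS.
Proof.
move=> subXU; rewrite sumsmxMr_gen; apply/sumsmx_subP=> h Kh.
rewrite genmxE (eqmxMr _ (genmxE _)); apply: sub_simple_tensors => y Yy.
rewrite mulmxA mulmxBr /simple_tensor -!tprodE !mulmx1 !mul1mx mulmxBl /=.
rewrite basis_row_mul //; exact: subXU.
Qed.

Lemma simple_tensor_repr p y g (D : 'M[F]_(p, d)) : y \in carrier Y ->
  simple_tensor y D *m tensor_repr d (biset_bimodule F Y) g =
  simple_tensor (lact Y g y) D.
Proof. by move=> Yy; rewrite /simple_tensor -tprodE mulmx1 basis_row_mul. Qed.
End TensorOfBiset.

Section TensorMap.
Variables (gT kT lT : finGroupType).
Variables (G : {group gT}) (K : {group kT}) (L : {group lT}).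
Variables (T T' : finType) (Y : biset G K T) (Z : biset G L T') (d : nat).

(** The linear map that sends y (x) w to f y (x) D y w. *)
Definition tensor_map (f : T -> T') (D : T -> 'M[F]_d) :
    'M[F]_(#|Y| * d, #|Z| * d) :=
  \sum_i tprod ((row i 1%:M)^T *m basis_row F Z (f (enum_val i)))
               (D (enum_val i)).

Lemma tensor_mapE f D p y (C : 'M[F]_(p, d)) : y \in carrier Y ->
  simple_tensor Y y C *m tensor_map f D = simple_tensor Z (f y) (C *m D y).
Proof.
move=> Yy; rewrite mulmx_sumr (bigD1 (enum_rank_in Yy y)) //= big1 ?addr0.
  rewrite -tprodE mulmxA -{1}(enum_rankK_in Yy Yy) -row1_basis row1_tr eqxx.
  by rewrite mul1mx enum_rankK_in.
move=> i ne; rewrite -tprodE mulmxA -(enum_rankK_in Yy Yy) -row1_basis row1_tr.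
by rewrite eq_sym (negbTE ne) raddf0 mul0mx tprod0l.
Qed.
End TensorMap.

(** The hypotheses say that Y is the balanced product of G and K over H, with H
    acting on G through f: every point is a translate g y0 h of y0, and two
    such expressions of a point differ by an element of H moved across y0. The
    isomorphism sends g (x) w to g y0 (x) w; its inverse sends y = g y0 h,
    for any choice of g and h, to g (x) h w. *)
Lemma tensor_over_induced_rsim (gT kT : finGroupType) (G : {group gT})
    (K H : {group kT}) (sHK : H \subset K)
    (f : {morphism H >-> gT}) (sfHG : f @* H \subset G)
    (T : finType) (Y : biset G K T) d (W : mx_representation F K d) (y0 : T)
    (Yy0 : y0 \in carrier Y)
    (trans_y0 : forall y, y \in carrier Y ->
       exists g h, [/\ g \in G, h \in K & y = Defs.ract Y h (lact Y g y0)])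
    (ract_y0 : forall h, h \in H -> Defs.ract Y h y0 = lact Y (f h) y0)
    (stab_y0 : forall g h, g \in G -> h \in K ->
       lact Y g y0 = Defs.ract Y h y0 -> h \in H /\ g = f h) :
  mx_rsim (induced sfHG (subg_repr W sHK)) (tensor_over (biset_bimodule F Y) W).
Proof.
pose R := reg_biset sfHG.
have fG h : h \in H -> f h \in G.
  by move=> Hh; apply: (subsetP sfHG); apply: mem_morphim.
have Yl g : g \in G -> lact Y g y0 \in carrier Y.
  by move=> Gg; apply: lact_closed.
pose P y (gh : gT * kT) :=
  [&& gh.1 \in G, gh.2 \in K & y == Defs.ract Y gh.2 (lact Y gh.1 y0)].
pose c y := odflt 1%g [pick gh | P y gh].
have cP y : y \in carrier Y ->
    [/\ (c y).1 \in G, (c y).2 \in K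
      & y = Defs.ract Y (c y).2 (lact Y (c y).1 y0)].
  move=> Yy; rewrite /c; case: pickP => [gh /and3P[? ? /eqP]|/=] //.
  have [g [h [Gg Kh e]]] := trans_y0 y Yy.
  by move/(_ (g, h)); rewrite /P /= Gg Kh -e eqxx.
(* If g y0 k = g' y0 k', then h = k'^-1 k lies in H and g' = g (f h) moves f h *)
(* across the tensor sign, so that g (x) k w and g' (x) k' w agree.          *)
have well g g' k k' : g \in G -> g' \in G -> k \in K -> k' \in K ->
    Defs.ract Y k (lact Y g y0) = Defs.ract Y k' (lact Y g' y0) ->
    (simple_tensor R g (W k) - simple_tensor R g' (W k')
       <= balanced R (subg_repr W sHK))%MS.
  move=> Gg Gg' Kk Kk' e; set h := (k'^-1 * k)%g.
  have Kh : h \in K by rewrite groupM ?groupV.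
  have [Hh fh] : h \in H /\ (g' * g^-1)%g = f h.
    apply: stab_y0; rewrite ?groupM ?groupV //.
    rewrite lactM ?groupV //.
    have -> : lact Y g' y0 = Defs.ract Y h (lact Y g y0).
      by rewrite ractM ?groupV ?Yl // e -ractM ?groupV ?Yl // mulVg ract1 ?Yl.
    by rewrite lractC ?groupV ?Yl // -lactM ?groupV // mulgV lact1.
  have -> : g' = Defs.ract R h g by rewrite /= -fh mulgKV.
  have -> : W k = W k' *m W h by rewrite -repr_mxM // mulKVg.
  rewrite -opprB eqmx_opp.
  exact: (simple_tensor_balanced (subg_repr W sHK) (W k') (_ : g \in R) Hh).
pose A := tensor_map R Y (fun g => lact Y g y0) (fun _ => (1%:M : 'M[F]_d)).
pose B := tensor_map Y R (fun y => (c y).1) (fun y => W (c y).2).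
apply: (@factmod_rsim _ _ _ _ _ _ _ _ _ _ A B).
- move=> g Gg; apply/eqP; rewrite -subr_eq0 -submx0.
  apply: sub_simple_tensors => x Gx; rewrite mulmxBr !mulmxA.
  rewrite simple_tensor_repr // !tensor_mapE //=; last by rewrite groupM.
  by rewrite simple_tensor_repr ?Yl // lactM // subrr sub0mx.
- apply: balanced_mulmx => x h Gx Hh.
  rewrite !tensor_mapE //=; last by rewrite groupM ?fG.
  rewrite mul1mx mulmx1 lactM ?fG // -ract_y0 // lractC ?(subsetP sHK) //.
  rewrite -[W h]mul1mx; apply: simple_tensor_balanced; rewrite ?Yl //.
  exact: (subsetP sHK).
- apply: balanced_mulmx => y h Yy Kh; rewrite !tensor_mapE ?ract_closed // mul1mx.
  have [Gg Kk e] := cP y Yy; have [Gg' Kk' e'] := cP _ (ract_closed Kh Yy).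
  rewrite -repr_mxM //; apply: well; rewrite ?groupM //.
  by rewrite -e' {1}e ractM ?Yl.
- apply: sub_simple_tensors => g Gg; rewrite mulmxBr mulmxA !tensor_mapE ?Yl //.
  rewrite !mul1mx mulmx1 -(repr_mx1 W).
  have [Gg' Kk' e'] := cP _ (Yl _ Gg).
  by apply: well => //; rewrite -e' ract1 ?Yl.
apply: sub_simple_tensors => y Yy; have [Gg Kk e] := cP y Yy.
rewrite mulmxBr mulmxA !tensor_mapE // !mul1mx !mulmx1 -opprB eqmx_opp {1}e.
by rewrite -[W _ in X in (X <= _)%MS]mul1mx simple_tensor_balanced ?Yl.
Qed.
End TensorProducts.

(** * Elements of the dual symmetric inverse semigroup as maps between blocks *)

Lemma ordering_perm (T : finType) (A : {set T}) k (a b : ordering A k) :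
  exists u : 'S_k, forall i, b i = a (u i).
Proof.
have ex i : {j | b i == a j}.
  by apply: sigW; have [j ->] := ordering_surj a (ordering_mem b i); exists j.
have inj : injective (fun i => sval (ex i)).
  move=> i j e; apply: (@ordering_inj _ _ _ b).
  by rewrite (eqP (svalP (ex i))) e -(eqP (svalP (ex j))).
by exists (perm inj) => i; rewrite permE -(eqP (svalP (ex i))).
Qed.

Lemma ones_act k l (N : 'M[bool]_(k, l)) h e :
  (e \in ones (mx_act N h)) = (entry_act h^-1%g e \in ones N).
Proof. by case: e => i j; rewrite !inE /= mxE. Qed.

Section BlockImages.
Variable n : nat.
Implicit Types (x y : dualsym n) (A B : {set 'I_n}).

(** The union has exactly one term when A is a domain part of x. *)
Definition block_image x A : {set 'I_n} :=
  \bigcup_(p in graph x | p.1 == A) p.2.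

Lemma block_imageE x p : p \in graph x -> block_image x p.1 = p.2.
Proof.
move=> xp; rewrite /block_image (big_pred1 p) // => q /=.
apply/andP/eqP=> [[xq /eqP e]|->]; last by rewrite xp.
exact: (block_bij_inj1 (graphP x)) e.
Qed.

Lemma block_image_graph x A : A \in gdom x -> (A, block_image x A) \in graph x.
Proof. by case/imsetP=> p xp ->; rewrite block_imageE // -surjective_pairing. Qed.

Lemma block_image_inj x : {in gdom x &, injective (block_image x)}.
Proof.
move=> A B xA xB e.
have := block_bij_inj2 (graphP x) (block_image_graph xA) (block_image_graph xB) e.
by case.
Qed.

Lemma gcod_block_image x : gcod x = block_image x @: gdom x.
Proof.
by rewrite /gcod /gdom -imset_comp; apply: eq_in_imset => p xp; rewrite /= block_imageE.
Qed.

Lemma dualsym_ext x y : gdom x = gdom y ->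
  {in gdom x, block_image x =1 block_image y} -> x = y.
Proof.
have graphE z : graph z = [set (A, block_image z A) | A in gdom z].
  rewrite /gdom -imset_comp -[LHS]imset_id; apply: eq_in_imset => p zp /=.
  by rewrite block_imageE // -surjective_pairing.
move=> eqd eqi; apply: val_inj; rewrite /= (graphE x) (graphE y) -eqd.
by apply: eq_in_imset => A xA; rewrite eqi.
Qed.

Section Orderings.
Variables (R : setpart n) (k : nat) (r : ordering R k).

Lemma block_image_syml g x A : coarser R (gcod x) -> A \in gdom x ->
  block_image (dmul (sym_elt r g) x) A = push r g (block_image x A).
Proof.
move=> cRx xA.
apply: (@block_imageE (dmul (sym_elt r g) x) (A, push r g (block_image x A))).
rewrite [graph _]gmul_syml //; apply/imsetP; exists (A, block_image x A) => //.
exact: block_image_graph.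
Qed.

Lemma block_image_symr g x i : gdom x = R ->
  block_image (dmul x (sym_elt r g)) (r i) = block_image x (r (g i)).
Proof.
move=> dx.
apply: (@block_imageE (dmul x (sym_elt r g)) (r i, block_image x (r (g i)))).
rewrite [graph _]gmul_symr //; apply/imsetP.
exists (r (g i), block_image x (r (g i))); last by rewrite /= push_block permK.
by apply: block_image_graph; rewrite dx ordering_mem.
Qed.

Lemma image_orderingP x : gdom x = R ->
  injectiveb [ffun i => block_image x (r i)] &&
  ([ffun i => block_image x (r i)] @: setT == gcod x).
Proof.
move=> dx; apply/andP; split.
  apply/injectiveP=> i j; rewrite !ffunE => e; apply: (@ordering_inj _ _ _ r).
  by apply: (@block_image_inj x) e; rewrite dx ordering_mem.
apply/eqP; rewrite gcod_block_image dx.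
have imR := congr1 (fun X : {set {set 'I_n}} => block_image x @: X)
  (ordering_im r).
apply: (etrans _ imR); rewrite -imset_comp.
by apply: eq_imset => i; rewrite ffunE.
Qed.

Definition image_ordering x (dx : gdom x = R) : ordering (gcod x) k :=
  Ordering (image_orderingP dx).

(** An element of Lclass R whose codomain is coarser than T amounts to a
    labelling c of the blocks of T by the blocks of R: blocks with the same
    label are merged into one codomain part. *)
Section Glue.
Variables (T : setpart n) (m : nat) (t : ordering T m) (c : 'I_m -> 'I_k).
Hypothesis surj_c : forall i, exists x : 'I_m, c x = i.

Definition merged i : {set 'I_n} := \bigcup_(x : 'I_m | c x == i) t x.

Lemma mem_merged a i : reflect (exists2 x : 'I_m, c x = i & a \in t x) (a \in merged i).
Proof.
apply: (iffP bigcupP) => [[x /eqP]|[x cx]]; first by exists x.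
by exists x; rewrite ?cx.
Qed.

Lemma merged_eq a i j : a \in merged i -> a \in merged j -> i = j.
Proof.
case/mem_merged=> x <- ax /mem_merged[y <- ay].
by rewrite (mem_block ax ay).
Qed.

Lemma merged_n0 i : exists a, a \in merged i.
Proof.
have [x cx] := surj_c i; have [a ax] := block_n0 t x.
by exists a; apply/mem_merged; exists x.
Qed.

Lemma merged_inj : injective merged.
Proof.
move=> i j e; have [a ai] := merged_n0 i.
by apply: (merged_eq ai); rewrite -e.
Qed.

Lemma merged_partition : partition (merged @: setT) setT.
Proof.
apply: partition_intro => [a|_ _ a /imsetP[i _ ->] /imsetP[j _ ->] ai aj|].
- have [A TA aA] := partition_ex a (blocksP T); have [x eA] := ordering_surj t TA.
  exists (merged (c x)); first exact: imset_f.
  by apply/mem_merged; exists x; rewrite // -eA.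
- by rewrite (merged_eq ai aj).
by move=> _ /imsetP[i _ ->]; apply: merged_n0.
Qed.

Definition merge_graph : {set {set 'I_n} * {set 'I_n}} :=
  [set (r i, merged i) | i : 'I_k].

Lemma gdom_merge_graph : gdom merge_graph = R.
Proof.
apply: etrans (ordering_im r); rewrite /gdom -imset_comp.
by apply/setP=> A; apply/imsetP/imsetP=> -[i _ ->]; exists i.
Qed.

Lemma merge_graphP : is_block_bij merge_graph.
Proof.
rewrite /is_block_bij gdom_merge_graph blocksP /=; apply/andP; split.
  rewrite /gcod -imset_comp; congr (partition _ _): merged_partition.
  by apply/setP=> A; apply/imsetP/imsetP=> -[i _ ->]; exists i.
apply/forall_inP=> _ /imsetP[i _ ->]; apply/forall_inP=> _ /imsetP[j _ ->] /=.
by rewrite (inj_eq (@ordering_inj _ _ _ r)) (inj_eq merged_inj).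
Qed.

Definition merge_elt : dualsym n := DualSym merge_graphP.

Lemma block_image_merge i : block_image merge_elt (r i) = merged i.
Proof. by apply: (@block_imageE merge_elt (r i, merged i)); apply: imset_f. Qed.
End Glue.
End Orderings.
End BlockImages.

(** * Pairs of elements as labelled 0/1-matrices *)

Section Cells.
Variables (n : nat) (R S T : setpart n) (k l m : nat).
Variables (r : ordering R k) (s : ordering S l) (t : ordering T m).
Implicit Types (p q : dualsym n * dualsym n) (e : 'I_k * 'I_l).

(** The orderings r and s label the parts of the two codomains of a pair p by
    rows and columns; the cells are the intersections of these labelled parts.
    For p in Yset the non-empty ones are the parts of T, and the family of all
    cells determines p, so p amounts to a matrix together with a bijection from
    its entries equal to 1 to the parts of T. *)
Definition cell p e := block_image p.1 (r e.1) :&: block_image p.2 (s e.2).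

Definition cell_mx p : 'M[bool]_(k, l) := \matrix_(i, j) (cell p (i, j) != set0).

Lemma ones_cell_mx p e : (e \in ones (cell_mx p)) = (cell p e != set0).
Proof. by case: e => i j; rewrite inE mxE. Qed.

Lemma cell_lact g p e : p \in Yset R S T -> cell (Ylact t g p) e = push t g (cell p e).
Proof.
case/YsetP=> d1 d2 /meet_coarser[c1 c2]; rewrite /cell /= -pushI.
by rewrite !block_image_syml // ?d1 ?d2 ordering_mem.
Qed.

Lemma cell_ract h p e : p \in Yset R S T ->
  cell (Yract r s h p) e = cell p (entry_act h e).
Proof. by case/YsetP=> d1 d2 _; rewrite /cell /= !block_image_symr. Qed.

Lemma mem_cell_inj p e e' a : p \in Yset R S T ->
  a \in cell p e -> a \in cell p e' -> e = e'.
Proof.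
case: e e' => i j [i' j'] /YsetP[d1 d2 _] /setIP[ai aj] /setIP[ai' aj'].
have inj (x : dualsym n) (Q : setpart n) z (q : ordering Q z) c c' : gdom x = Q ->
    a \in block_image x (q c) -> a \in block_image x (q c') -> c = c'.
  move=> dx ac ac'; apply: (@ordering_inj _ _ _ q).
  have dq c0 : q c0 \in gdom x by rewrite dx ordering_mem.
  apply: (@block_image_inj _ x); rewrite ?dq //.
  have cq c0 : block_image x (q c0) \in gcod x.
    by rewrite gcod_block_image; apply: imset_f; apply: dq.
  exact: partition_eq (gcodP x) (cq c) (cq c') ac ac'.
by congr pair; [apply: (inj _ _ _ r) d1 ai ai' | apply: (inj _ _ _ s) d2 aj aj'].
Qed.

Lemma ex_cell p a : p \in Yset R S T -> exists e, a \in cell p e.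
Proof.
case/YsetP=> d1 d2 _.
have ex (x : dualsym n) (Q : setpart n) z (q : ordering Q z) : gdom x = Q ->
    exists c, a \in block_image x (q c).
  move=> dx; have [A] := partition_ex a (gcodP x).
  rewrite gcod_block_image dx => /imsetP[B QB ->] aB.
  by have [c eB] := ordering_surj q QB; exists c; rewrite -eB.
have [i ai] := ex _ _ _ r d1; have [j aj] := ex _ _ _ s d2.
by exists (i, j); rewrite inE ai aj.
Qed.

Lemma cell_block p e : p \in Yset R S T -> cell p e != set0 -> exists x, cell p e = t x.
Proof.
move=> Yp n0; apply: ordering_surj; have /YsetP[d1 d2 <-] := Yp.
rewrite !gcod_block_image d1 d2; apply: imset2_f; first by rewrite imset_f ?ordering_mem.
by rewrite inE imset_f ?ordering_mem.
Qed.

(** A codomain part is the union of the cells in its row or column. *)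
Lemma cell_ext p q : p \in Yset R S T -> q \in Yset R S T -> cell p =1 cell q -> p = q.
Proof.
move=> Yp Yq eqc; have /YsetP[d1 d2 _] := Yp; have /YsetP[d1' d2' _] := Yq.
have sub p' q' : p' \in Yset R S T -> q' \in Yset R S T -> cell p' =1 cell q' ->
    (forall i, block_image p'.1 (r i) \subset block_image q'.1 (r i)) /\
    (forall j, block_image p'.2 (s j) \subset block_image q'.2 (s j)).
  move=> Yp' Yq' eqc'; split=> [i|j]; apply/subsetP=> a ai.
    have [[i' j] ae] := ex_cell a Yp'.
    have eii' : i = i'.
      have /setIP[_ aj] := ae.
      have ae' : a \in cell p' (i, j) by rewrite inE ai.
      by case: (mem_cell_inj Yp' ae ae').
    by move: ae; rewrite eqc' -eii' => /setIP[].
  have [[i j'] ae] := ex_cell a Yp'.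
  have ejj' : j = j'.
    have /setIP[aj _] := ae.
    have ae' : a \in cell p' (i, j) by rewrite inE aj.
    by case: (mem_cell_inj Yp' ae ae').
  by move: ae; rewrite eqc' -ejj' => /setIP[].
have [pq1 pq2] := sub _ _ Yp Yq eqc.
have [qp1 qp2] := sub _ _ Yq Yp (fun e => esym (eqc e)).
have e1 : p.1 = q.1.
  apply: dualsym_ext => [|A]; rewrite d1 ?d1' // => RA.
  by have [i ->] := ordering_surj r RA; apply/eqP; rewrite eqEsubset pq1 qp1.
have e2 : p.2 = q.2.
  apply: dualsym_ext => [|A]; rewrite d2 ?d2' // => SA.
  by have [j ->] := ordering_surj s SA; apply/eqP; rewrite eqEsubset pq2 qp2.
by rewrite [p]surjective_pairing e1 e2 -surjective_pairing.
Qed.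

(** The orderings of the codomains in the definition of YOset differ from those
    induced by r and s by permutations, under which O is stable. *)
Lemma cell_mx_YO (O : {set 'M[bool]_(k, l)}) p :
    (forall N g, N \in O -> mx_act N g \in O) ->
  (p \in YOset R S T O) = (p \in Yset R S T) && (cell_mx p \in O).
Proof.
move=> Oact; rewrite inE; apply: andb_id2l => /YsetP[d1 d2 _].
have cellE : cell_mx p = incidence (image_ordering r d1) (image_ordering s d2).
  by apply/matrixP=> i j; rewrite !mxE /= !ffunE.
apply/existsP/idP=> [[a /existsP[b Oab]]|Op]; last first.
  exists (image_ordering r d1); apply/existsP.
  by exists (image_ordering s d2); rewrite -cellE.
have [u eu] := ordering_perm a (image_ordering r d1).
have [v ev] := ordering_perm b (image_ordering s d2).
suff -> : cell_mx p = mx_act (incidence a b) (u^-1, v^-1)%g by apply: Oact.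
by apply/matrixP=> i j; rewrite cellE !mxE eu ev !invgK.
Qed.

Section BasePoint.
Variables (M : 'M[bool]_(k, l)) (b : ordering (ones M) m).
Hypothesis rowM : forall i, exists j, M i j.
Hypothesis colM : forall j, exists i, M i j.

Lemma surj_rows i : exists x, (b x).1 = i.
Proof.
have [j Mij] := rowM i.
have [|x e] := @ordering_surj _ _ _ b (i, j); first by rewrite inE.
by exists x; rewrite -e.
Qed.

Lemma surj_cols j : exists x, (b x).2 = j.
Proof.
have [i Mij] := colM j.
have [|x e] := @ordering_surj _ _ _ b (i, j); first by rewrite inE.
by exists x; rewrite -e.
Qed.

(** The pair corresponding to the matrix M and the bijection from its entries
    to the blocks of T that b and t induce. *)
Definition base_pair : dualsym n * dualsym n :=
  (merge_elt r t surj_rows, merge_elt s t surj_cols).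

Lemma mem_cell_base e a :
  reflect (exists2 x, b x = e & a \in t x) (a \in cell base_pair e).
Proof.
rewrite /cell !block_image_merge; apply: (iffP setIP).
  case=> /mem_merged[x ex ax] /mem_merged[y ey ay].
  exists x => //; rewrite [b x]surjective_pairing ex (mem_block ax ay) ey.
  by rewrite -surjective_pairing.
by case=> x <- ax; split; apply/mem_merged; exists x.
Qed.

Lemma cell_base x : cell base_pair (b x) = t x.
Proof.
apply/setP=> a; apply/mem_cell_base/idP=> [[y /ordering_inj->] //|ax].
by exists x.
Qed.

Lemma cell_mx_base : cell_mx base_pair = M.
Proof.
apply/matrixP=> i j; rewrite mxE; apply/set0Pn/idP=> [[a /mem_cell_base[x ex _]]|Mij].
  by have := ordering_mem b x; rewrite ex inE.
have [|x ->] := @ordering_surj _ _ _ b (i, j); first by rewrite inE.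
by rewrite cell_base; apply: block_n0.
Qed.

Lemma cell_base_n0 e : (cell base_pair e != set0) = (e \in ones M).
Proof. by rewrite -ones_cell_mx cell_mx_base. Qed.

Lemma base_pair_Y : base_pair \in Yset R S T.
Proof.
have d1 : gdom base_pair.1 = R by apply: gdom_merge_graph.
have d2 : gdom base_pair.2 = S by apply: gdom_merge_graph.
apply/YsetP; split=> //; rewrite !gcod_block_image d1 d2.
apply/setP=> C; apply/imset2P/idP=> [[_ B' /imsetP[A RA ->]]|].
  rewrite inE => /andP[/imsetP[B SB ->]].
  have [i ->] := ordering_surj r RA; have [j ->] := ordering_surj s SB.
  rewrite -[X in X != set0]/(cell base_pair (i, j)) cell_base_n0 => Me ->.
  have [x e] := ordering_surj b Me.
  by rewrite -[X in X \in _]/(cell base_pair (i, j)) e cell_base ordering_mem.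
case/(ordering_surj t)=> x ->; rewrite -cell_base.
exists (block_image base_pair.1 (r (b x).1)) (block_image base_pair.2 (s (b x).2)) => //.
  by rewrite imset_f ?ordering_mem.
rewrite inE imset_f ?ordering_mem //= -[X in X != set0]/(cell base_pair (b x)).
by rewrite cell_base_n0 ordering_mem.
Qed.

Variable O : {set 'M[bool]_(k, l)}.
Hypothesis defO : O = orbit (mx_action k l) [set: 'S_k * 'S_l] M.

Lemma orbit_act N g : N \in O -> mx_act N g \in O.
Proof.
rewrite defO => /orbitP[h _ <-]; apply/orbitP; exists (h * g)%g; first exact: in_setT.
by rewrite /= mx_actM.
Qed.

Lemma YO_Y p : p \in YOset R S T O -> p \in Yset R S T.
Proof. by rewrite inE => /andP[]. Qed.

Lemma base_pair_YO : base_pair \in YOset R S T O.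
Proof.
by rewrite (cell_mx_YO _ orbit_act) base_pair_Y cell_mx_base defO orbit_refl.
Qed.

(** Permuting rows and columns by h permutes the non-empty cells, which by
    definition of ones_perm amounts to permuting the blocks of T. *)
Lemma ract_base_pair h : h \in mx_stab M ->
  Yract r s h base_pair = Ylact t (ones_perm b h) base_pair.
Proof.
move=> Hh; have YOb := base_pair_YO.
apply: cell_ext; [apply/YO_Y/Yract_closed/YOb|apply/YO_Y/Ylact_closed/YOb|move=> e].
rewrite cell_ract ?cell_lact ?base_pair_Y //.
have [/(ordering_surj b)[x ->]|Me] := boolP (e \in ones M).
  by rewrite -ones_permE // !cell_base push_block.
have /negPn/eqP -> : ~~ (cell base_pair e != set0) by rewrite cell_base_n0.
apply/eqP; rewrite push0 -[_ == _]negbK cell_base_n0.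
by rewrite (mx_stabP Hh).
Qed.

(** The left action does not change which cells are empty, so h fixes M; the
    labels of the non-empty cells then determine g. *)
Lemma stab_base_pair g h : Ylact t g base_pair = Yract r s h base_pair ->
  h \in mx_stab M /\ g = ones_perm b h.
Proof.
move=> e; have cellE c : push t g (cell base_pair c) = cell base_pair (entry_act h c).
  by rewrite -cell_lact ?base_pair_Y // e cell_ract ?base_pair_Y.
have pushn0 (g' : 'S_m) B : push t g' B != set0 -> B != set0.
  by apply: contraNneq => ->; rewrite push0.
have Mh c : c \in ones M -> entry_act h c \in ones M.
  case/(ordering_surj b)=> x ->; rewrite -cell_base_n0 -cellE.
  by rewrite cell_base push_block; apply/set0Pn/block_n0.
have Mh' c : entry_act h c \in ones M -> c \in ones M.
  by rewrite -!cell_base_n0 -cellE; apply: pushn0.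
have Hh : h \in mx_stab M.
  apply/astab1P/matrixP=> i j /=; rewrite mxE.
  apply/idP/idP=> Mc; last first.
    have := Mh' (h.1^-1%g i, h.2^-1%g j); rewrite /entry_act /= !permKV !inE /=.
    exact.
  by have := Mh (h.1^-1%g i, h.2^-1%g j); rewrite /entry_act /= !permKV !inE /=; apply.
split=> //; apply/permP=> x; apply: (@ordering_inj _ _ _ t).
by rewrite -push_block -!cell_base cellE ones_permE.
Qed.

(** A suitable h brings the matrix of p to M; the remaining freedom is the
    bijection from the entries of M to the blocks of T, on which the
    permutations g act transitively. *)
Lemma trans_base_pair p : p \in YOset R S T O ->
  exists g h, p = Yract r s h (Ylact t g base_pair).
Proof.
move=> YOp; have Yp := YO_Y YOp; have YOb := base_pair_YO.
have : cell_mx p \in O by move: YOp; rewrite (cell_mx_YO _ orbit_act) Yp.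
rewrite defO => /orbitP[h _ Mh]; set q := Yract r s h p.
have YOq : q \in YOset R S T O by apply: Yract_closed.
have Yq := YO_Y YOq.
have q_ones c : (cell q c != set0) = (c \in ones M).
  rewrite cell_ract // -ones_cell_mx -Mh ones_act /entry_act /= !permK.
  by rewrite -surjective_pairing.
have ex x : {y | cell q (b x) == t y}.
  apply: sigW; have [|y ->] := @cell_block q (b x) Yq; last by exists y.
  by rewrite q_ones ordering_mem.
have inj : injective (fun x => sval (ex x)).
  move=> x y e; apply: (@ordering_inj _ _ _ b).
  have [a ax] := block_n0 t (sval (ex x)).
  apply: (mem_cell_inj (a := a) Yq); first by rewrite (eqP (svalP (ex x))).
  by rewrite (eqP (svalP (ex y))) -e.
exists (perm inj), h^-1%g.
suff -> : Ylact t (perm inj) base_pair = q.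
  by rewrite /q -(YractM _ _ _ _ YOp) mulVg (Yract1 _ _ YOp).
apply: cell_ext => // [|c]; first by apply/YO_Y/Ylact_closed/YOb.
rewrite cell_lact ?base_pair_Y //.
have [/(ordering_surj b)[x ->]|Mc] := boolP (c \in ones M).
  by rewrite cell_base push_block permE -(eqP (svalP (ex x))).
have /negPn/eqP -> : ~~ (cell base_pair c != set0) by rewrite cell_base_n0.
by rewrite push0; apply/esym/eqP/negPn; rewrite q_ones.
Qed.
End BasePoint.
End Cells.

Theorem proposition7 (F : closedFieldType) (F0 : [pchar F] =i pred0)
    (n k l m : nat) (rho sigma tau : setpart n)
    (r : ordering rho k) (s : ordering sigma l) (t : ordering tau m)
    (O : {set 'M[bool]_(k, l)})
    (orbO : O \in orbit (mx_action k l) [set: 'S_k * 'S_l] @: Qset k l m)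
    (M : 'M[bool]_(k, l)) (OM : M \in O) (b : ordering (ones M) m)
    (la mu nu : seq nat) (partla : integer_partition k la)
    (partmu : integer_partition l mu) (partnu : integer_partition m nu) :
  let W := outer_tensor (specht F k la) (specht F l mu) in
  let H := mx_stab M in
  multiplicity
    (tensor_over (biset_bimodule F (YObiset r s t O)) W)
    (specht F m nu) =
  multiplicity
    (induced (f := ones_morphism b) (subsetT _) (subg_repr W (subsetT H)))
    (specht F m nu).
Proof.
move=> W H; have [N QN defON] := imsetP orbO.
have defO : O = orbit (mx_action k l) [set: 'S_k * 'S_l] M.
  by rewrite defON; apply/esym/orbit_eqP; rewrite -defON.
move: QN; rewrite inE => /and3P[_ /'forall_existsP rowN /'forall_existsP colN].
have [g _ defM] : exists2 g, g \in [set: 'S_k * 'S_l] & mx_act N g = M.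
  by apply/orbitP; rewrite -defON.
have rowM i : exists j, M i j.
  by have [j Nij] := rowN (g.1^-1%g i); exists (g.2 j); rewrite -defM mxE permK.
have colM j : exists i, M i j.
  by have [i Nij] := colN (g.2^-1%g j); exists (g.1 i); rewrite -defM mxE permK.
apply/esym/multiplicity_rsim.
pose y0 := base_pair r s t b rowM colM.
apply: (@tensor_over_induced_rsim _ _ _ _ _ _ _ _ _ _ _ _ _ y0).
- exact: base_pair_YO defO.
- move=> p /(trans_base_pair r s t b rowM colM defO)[x [h ->]].
  by exists x, h; rewrite !inE.
- by move=> h Hh; apply: (ract_base_pair r s t b rowM colM defO).
by move=> x h _ _; apply: stab_base_pair.
Qed.
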